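(* The essential image of the functor $\mathcal{P}_p:\mathbf{RiOp}\to\mathbf{LT}$, the composite of the full inclusion $\mathbf{RiOp}\to\mathbf{SOp}$ of rigid operads into symmetric operads with the functor $\mathcal{P}_a:\mathbf{SOp}\to\mathbf{LT}$, is the category $\mathbf{RiLT}$ of rigid Lawvere theories and analytic interpretations between them.
   Context: Notation: $(n]=\{1,\dots,n\}$. 'The essential image of a functor $F$ is the (not necessarily full) replete subcategory $\mathbf{D}$' means that $F$ factorizes as a functor onto $\mathbf{D}$, full and essentially surjective on objects, followed by the inclusion of $\mathbf{D}$. Symmetric operads. A symmetric operad $\mathcal{O}$ consists of sets $\mathcal{O}_n$ ($n\in\omega$), a unit $\iota\in\mathcal{O}_1$, compositions $\ast:\mathcal{O}_{n_1}\times\dots\times\mathcal{O}_{n_k}\times\mathcal{O}_k\to\mathcal{O}_n$ with $n=\sum_i n_i$, written $\langle f_1,\dots,f_k\rangle\ast f$, and left actions $\cdot:S_n\times\mathcal{O}_n\to\mathcal{O}_n$, such that composition is associative with unit $\iota$ and compatible with the actions: $\langle\sigma_1\cdot f_1,\dots,\sigma_k\cdot f_k\rangle\ast(\tau\cdot f)=(\langle\sigma_1,\dots,\sigma_k\rangle\star\tau)\cdot(\langle f_{\tau(1)},\dots,f_{\tau(k)}\rangle\ast f)$, where $\langle\sigma_1,\dots,\sigma_k\rangle\star\tau:\sum_i n_{\tau(i)}\to\sum_i n_i$ is $\langle i,r\rangle\mapsto\langle\tau(i),\sigma_{\tau(i)}(r)\rangle$ (lexicographic orders). Morphisms preserve arities,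 unit, compositions and actions. The category is $\mathbf{SOp}$. The category $\mathbf{RiOp}$ of rigid operads is (identified with) the full subcategory of $\mathbf{SOp}$ on the operads for which all actions of the symmetric groups are free. Lawvere theories. A Lawvere theory $\mathbf{T}$ is a category with objects the natural numbers in which $n$ is the product $1^n$ with chosen projections $\pi^n_i:n\to1$ ($i\in(n]$), $\pi^1_1=\mathrm{id}_1$. Morphisms (interpretations) are identity-on-objects functors preserving the chosen projections; the category is $\mathbf{LT}$. For $\phi:(m]\to(n]$, $\pi_\phi:n\to m$ is the morphism with $\pi^m_i\circ\pi_\phi=\pi^n_{\phi(i)}$. Structural morphisms in $\mathbf{T}$ form the closure under isomorphism of the class of all $\pi_\phi$. A morphism $a$ is analytic if it is right orthogonal to every structural morphism $s$: whenever $a\circ u=v\circ s$ there is a unique $d$ with $d\circ s=u$ and $a\circ d=v$. $\mathbf{T}$ has simple automorphisms if for every $n\in\omega$ the function $\rho_n:S_n\times\mathrm{Aut}(1)^n\to\mathrm{Aut}(n)$, $(\sigma,a_1,\dots,a_n)\mapsto(a_1\times\dots\times a_n)\circ\pi_\sigma$, is a bijection. $\mathbf{T}$ is analytic if structural and analytic morphisms form a factorization system (both classes are closed under isomorphisms, structural morphisms are left orthogonal to analytic ones, and every morphism is $a\circ s$ with $s$ structural and $a$ analytic) and $\mathbf{T}$ has simple automorphisms. $\mathbf{T}$ is rigid if it is analytic and for each $n$ the action $\sigma\cdot f=f\circ\pi_\sigma$ of $S_n$ on analytic morphisms $f:n\to1$ is free. An analytic interpretation is an interpretation preserving analytic morphisms.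 The functor $\mathcal{P}_a:\mathbf{SOp}\to\mathbf{LT}$. Objects of $\mathcal{P}_a(\mathcal{O})$ are natural numbers. A morphism $n\to m$ is an equivalence class of spans $\langle\phi,f,g_i\rangle_{i\in(m]}$, where for some $r\in\omega$, $\phi:(r]\to(n]$ is a function, $f:(r]\to(m]$ is monotone, and $g_i\in\mathcal{O}_{r_i}$ with $r_i=|f^{-1}(i)|$. Spans $\langle\phi,f,g_i\rangle$ and $\langle\phi',f',g'_i\rangle$ are equivalent iff $f=f'$ and there are $\sigma_i\in S_{r_i}$ with $g_i=\sigma_i\cdot g'_i$ and $\phi\circ\sum_i\sigma_i=\phi'$, where $\sum_i\sigma_i:(r]\to(r]$ is the permutation acting as $\sigma_i$ on the $i$-th fibre of $f$. The composite of $\langle\phi,f,g_i\rangle_{i\in(m]}:n\to m$ and $\langle\phi',f',g'_j\rangle_{j\in(k]}:m\to k$ (apexes $r,r'$) is $\langle\phi\circ\bar\phi,f'\circ\bar f,g''_j\rangle_{j\in(k]}$, where $\bar f:(r'']\to(r']$, $\bar\phi:(r'']\to(r]$ is the pullback of $f$ along $\phi'$ with $\bar f$ monotone and $\bar\phi$ increasing on each fibre of $\bar f$, and $g''_j=\langle g_{\phi'(l)}\rangle_{l\in f'^{-1}(j)}\ast g'_j$. The identity on $n$ is $\langle\mathrm{id}_n,\mathrm{id}_n,\iota\rangle$ and $\pi^n_i=\langle\bar i,\mathrm{id}_1,\iota\rangle$ with $\bar i:(1]\to(n]$, $\bar i(1)=i$. For $h:\mathcal{O}\to\mathcal{O}'$,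 $\mathcal{P}_a(h)\langle\phi,f,g_i\rangle=\langle\phi,f,h(g_i)\rangle$. *)

(* Defs.v *)
From HB Require Import structures.
From mathcomp Require Import all_boot all_order all_fingroup.
From mathcomp Require Import generic_quotient boolp.

Set Implicit Arguments.
Unset Strict Implicit.
Unset Printing Implicit Defensive.

Local Open Scope quotient_scope.

Lemma sval_inj (T : Type) (P : T -> Prop) (x y : {t : T | P t}) :
  sval x = sval y -> x = y.
Proof. by case: x y => [x xP] [y yP] /= e; apply: eq_exist. Qed.

(* The objects are a parameter, so that a Lawvere theory (a category on [nat])
   and the category of all Lawvere theories are instances of the same notion. *)
Record category (Ob : Type) := Category {
  hom : Ob -> Ob -> Type;
  idm : forall x, hom x x;
  comp : forall x y z, hom y z -> hom x y -> hom x z;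
  comp1m : forall x y (f : hom x y), comp (idm y) f = f;
  compm1 : forall x y (f : hom x y), comp f (idm x) = f;
  compA : forall x y z t (h : hom z t) (g : hom y z) (f : hom x y),
    comp h (comp g f) = comp (comp h g) f
}.
Arguments idm {Ob} c x.
Arguments comp {Ob c x y z}.

Notation "g \oc f" := (comp g f) (at level 50, left associativity).

Record functor (A B : Type) (C : category A) (D : category B) := Functor {
  fobj : A -> B;
  fmap : forall x y, hom C x y -> hom D (fobj x) (fobj y);
  fmap_id : forall x, fmap (idm C x) = idm D (fobj x);
  fmap_comp : forall x y z (g : hom C y z) (f : hom C x y),
    fmap (g \oc f) = fmap g \oc fmap f
}.
Arguments fobj {A B C D} F x : rename.
Arguments fmap {A B C D} F {x y} f : rename.

Section FunctorComp.
Variables (A B E : Type) (CA : category A) (CB : category B) (CE : category E).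
Variables (G : functor CB CE) (F : functor CA CB).

Let gf_map x y (f : hom CA x y) := fmap G (fmap F f).

Let gf_id x : gf_map (idm CA x) = idm CE (fobj G (fobj F x)).
Proof. by rewrite /gf_map !fmap_id. Qed.

Let gf_comp x y z (g : hom CA y z) (f : hom CA x y) :
  gf_map (g \oc f) = gf_map g \oc gf_map f.
Proof. by rewrite /gf_map !fmap_comp. Qed.

Definition functor_comp : functor CA CE := Functor gf_id gf_comp.
End FunctorComp.

Section CategoryTheory.
Variables (Ob : Type) (C : category Ob).

Definition inverse_of x y (f : hom C x y) (g : hom C y x) : Prop :=
  g \oc f = idm C x /\ f \oc g = idm C y.

Definition is_iso x y (f : hom C x y) : Prop := exists g, inverse_of f g.

Lemma is_iso_id x : is_iso (idm C x).
Proof. by exists (idm C x); split; rewrite comp1m. Qed.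

Lemma is_iso_comp x y z (g : hom C y z) (f : hom C x y) :
  is_iso g -> is_iso f -> is_iso (g \oc f).
Proof.
move=> [g' [g'g gg']] [f' [f'f ff']]; exists (f' \oc g'); split.
  by rewrite compA -(compA f') g'g compm1.
by rewrite compA -(compA g) ff' compm1.
Qed.

Definition aut x := {f : hom C x x | is_iso f}.

Definition mor_class := forall x y, hom C x y -> Prop.

Definition arrow_iso x y x' y' (f : hom C x y) (f' : hom C x' y') : Prop :=
  exists (i : hom C x x') (j : hom C y y'),
    [/\ is_iso i, is_iso j & j \oc f = f' \oc i].

Definition iso_closure (K : mor_class) : mor_class := fun x' y' f' =>
  exists x y (f : hom C x y), K x y f /\ arrow_iso f f'.

Definition iso_closed (K : mor_class) : Prop :=
  forall x y x' y' (f : hom C x y) (f' : hom C x' y'),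
    arrow_iso f f' -> K x y f -> K x' y' f'.

Definition orthogonal x y z t (s : hom C x y) (a : hom C z t) : Prop :=
  forall (u : hom C x z) (v : hom C y t), a \oc u = v \oc s ->
    exists! d : hom C y z, d \oc s = u /\ a \oc d = v.

Definition right_orthogonal (K : mor_class) : mor_class := fun z t a =>
  forall x y (s : hom C x y), K x y s -> orthogonal s a.

Definition factorization_system (L R : mor_class) : Prop :=
  [/\ iso_closed L, iso_closed R,
      forall x y z t (s : hom C x y) (a : hom C z t),
        L x y s -> R z t a -> orthogonal s a
    & forall x y (f : hom C x y), exists z (s : hom C x z) (a : hom C z y),
        [/\ L x z s, R z y a & f = a \oc s]].

(* Only the value of [in_hom] between objects of the subcategory matters. *)
Record subcategory := Subcategory {
  in_ob : Ob -> Prop;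
  in_hom : forall x y, hom C x y -> Prop;
  in_id : forall x, in_ob x -> in_hom (idm C x);
  in_comp : forall x y z (g : hom C y z) (f : hom C x y),
    in_hom g -> in_hom f -> in_hom (g \oc f)
}.

Definition replete (D : subcategory) : Prop :=
  forall x y (i : hom C x y), in_ob D x -> is_iso i -> in_ob D y /\ in_hom D i.

Section SubCat.
Variable D : subcategory.

Definition sub_ob := {x : Ob | in_ob D x}.
Definition sub_hom (x y : sub_ob) := {f : hom C (sval x) (sval y) | in_hom D f}.
Definition sub_id (x : sub_ob) : sub_hom x x :=
  exist _ (idm C (sval x)) (in_id (svalP x)).
Definition sub_comp (x y z : sub_ob) (g : sub_hom y z) (f : sub_hom x y) :
  sub_hom x z := exist _ (sval g \oc sval f) (in_comp (svalP g) (svalP f)).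

Let sub_comp1m x y (f : sub_hom x y) : sub_comp (sub_id y) f = f.
Proof. by apply: sval_inj; rewrite /= comp1m. Qed.
Let sub_compm1 x y (f : sub_hom x y) : sub_comp f (sub_id x) = f.
Proof. by apply: sval_inj; rewrite /= compm1. Qed.
Let sub_compA x y z t (h : sub_hom z t) (g : sub_hom y z) (f : sub_hom x y) :
  sub_comp h (sub_comp g f) = sub_comp (sub_comp h g) f.
Proof. by apply: sval_inj; rewrite /= compA. Qed.

Definition subcat : category sub_ob :=
  Category sub_comp1m sub_compm1 sub_compA.

Definition subcat_incl : functor subcat C :=
  @Functor _ _ subcat C sval (fun x y f => sval f)
    (fun=> erefl) (fun _ _ _ _ _ => erefl).
End SubCat.
End CategoryTheory.

Section EssentialImage.
Variables (A B : Type) (CA : category A) (CB : category B).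

Definition full (F : functor CA CB) : Prop :=
  forall x y (g : hom CB (fobj F x) (fobj F y)), exists f, fmap F f = g.

Definition essentially_surjective (F : functor CA CB) : Prop :=
  forall y : B, exists x (i : hom CB (fobj F x) y), is_iso i.
End EssentialImage.

Section Corestriction.
Variables (A B : Type) (CA : category A) (CB : category B).
Variables (F : functor CA CB) (D : subcategory CB).
Hypothesis Fob : forall x, in_ob D (fobj F x).
Hypothesis Fhom : forall x y (f : hom CA x y), in_hom D (fmap F f).

Let cor_ob x : sub_ob D := exist _ (fobj F x) (Fob x).
Let cor_map x y (f : hom CA x y) : sub_hom (cor_ob x) (cor_ob y) :=
  exist _ (fmap F f) (Fhom f).

Let cor_id x : cor_map (idm CA x) = idm (subcat D) (cor_ob x).
Proof. by apply: sval_inj; rewrite /= fmap_id. Qed.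

Let cor_comp x y z (g : hom CA y z) (f : hom CA x y) :
  cor_map (g \oc f) = comp (c := subcat D) (cor_map g) (cor_map f).
Proof. by apply: sval_inj; rewrite /= fmap_comp. Qed.

Definition corestrict : functor CA (subcat D) :=
  @Functor _ _ CA (subcat D) cor_ob cor_map cor_id cor_comp.
End Corestriction.

Definition is_essential_image A B (CA : category A) (CB : category B)
    (F : functor CA CB) (D : subcategory CB) : Prop :=
  replete D /\
  exists (Fob : forall x, in_ob D (fobj F x))
         (Fhom : forall x y (f : hom CA x y), in_hom D (fmap F f)),
    full (corestrict Fob Fhom) /\ essentially_surjective (corestrict Fob Fhom).

Record lawvere := Lawvere {
  lw_cat :> category nat;
  proj : forall n, 'I_n -> hom lw_cat n 1;
  proj_prod : forall m n (t : 'I_n -> hom lw_cat m 1),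
    exists! u : hom lw_cat m n, forall i, proj i \oc u = t i;
  proj_id1 : proj (ord0 : 'I_1) = idm lw_cat 1
}.
Arguments proj T {n} : rename.

Record interpretation (T T' : lawvere) := Interpretation {
  imap :> forall n m, hom T n m -> hom T' n m;
  imap_id : forall n, imap (idm T n) = idm T' n;
  imap_comp : forall n m k (g : hom T m k) (f : hom T n m),
    imap (g \oc f) = imap g \oc imap f;
  imap_proj : forall n (i : 'I_n), imap (proj T i) = proj T' i
}.
Arguments imap {T T'} i {n m} : rename.

Lemma interpretation_eq T T' (I J : interpretation T T') :
  (forall n m (f : hom T n m), I n m f = J n m f) -> I = J.
Proof.
case: I J => [I I1 I2 I3] [J J1 J2 J3] /= IJ.
have {}IJ : I = J.
  by apply: functional_extensionality_dep => n;
     apply: functional_extensionality_dep => m; apply: funext => f.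
by subst J; congr Interpretation; apply: Prop_irrelevance.
Qed.

Definition interp_id T : interpretation T T :=
  @Interpretation T T (fun _ _ f => f)
    (fun=> erefl) (fun _ _ _ _ _ => erefl) (fun _ _ => erefl).

Section InterpComp.
Variables (T T' T'' : lawvere).
Variables (J : interpretation T' T'') (I : interpretation T T').

Let ji n m (f : hom T n m) := imap J (imap I f).
Let ji_id n : ji (idm T n) = idm T'' n.
Proof. by rewrite /ji !imap_id. Qed.
Let ji_comp n m k (g : hom T m k) (f : hom T n m) :
  ji (g \oc f) = ji g \oc ji f.
Proof. by rewrite /ji !imap_comp. Qed.
Let ji_proj n (i : 'I_n) : ji (proj T i) = proj T'' i.
Proof. by rewrite /ji !imap_proj. Qed.

Definition interp_comp : interpretation T T'' :=
  Interpretation ji_id ji_comp ji_proj.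
End InterpComp.

Definition LT : category lawvere.
Proof.
by refine (@Category lawvere interpretation interp_id interp_comp _ _ _);
   move=> *; apply: interpretation_eq.
Defined.

Section LawvereTheory.
Variable T : lawvere.

Definition tupling m n (t : 'I_n -> hom T m 1) : hom T m n :=
  sval (cid (proj_prod t)).

Lemma proj_tupling m n (t : 'I_n -> hom T m 1) i : proj T i \oc tupling t = t i.
Proof. by rewrite /tupling; case: cid => u []. Qed.

Lemma proj_inj m n (u v : hom T m n) :
  (forall i, proj T i \oc u = proj T i \oc v) -> u = v.
Proof.
move=> uv; have [w [_ uniq_w]] := proj_prod (fun i => proj T i \oc u).
by rewrite -(uniq_w u) // -(uniq_w v) // => i; rewrite uv.
Qed.

(* [pi_map phi : n -> m] for [phi : (m] -> (n]]. *)
Definition pi_map n m (phi : 'I_m -> 'I_n) : hom T n m :=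
  tupling (fun i => proj T (phi i)).

(* The product [a_1 x ... x a_n : n -> n]. *)
Definition prod_map n (a : 'I_n -> hom T 1 1) : hom T n n :=
  tupling (fun i => a i \oc proj T i).

Definition structural : mor_class T :=
  iso_closure (fun n m f => exists phi : 'I_m -> 'I_n, f = pi_map phi).

Definition analytic : mor_class T := right_orthogonal structural.

Definition rho_mor n (x : 'S_n * ('I_n -> aut T 1)) : hom T n n :=
  prod_map (fun i => sval (x.2 i)) \oc pi_map x.1.

Lemma rho_iso n (x : 'S_n * ('I_n -> aut T 1)) : is_iso (rho_mor x).
Proof.
case: x => s a; apply: is_iso_comp => /=.
  have [b bP] : {b | forall i, inverse_of (sval (a i)) (b i)}.
    have/choice[b bP] i : exists g, inverse_of (sval (a i)) g by case: (a i).
    exact: cid (ex_intro _ b bP).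
  by exists (prod_map b); split; apply: proj_inj => i;
     rewrite compA /prod_map proj_tupling -compA proj_tupling compA;
     rewrite ?(proj1 (bP i)) ?(proj2 (bP i)) comp1m compm1.
exists (pi_map (s^-1)%g); split; apply: proj_inj => i;
  by rewrite compA /pi_map !proj_tupling ?permK ?permKV compm1.
Qed.

Definition rho n (x : 'S_n * ('I_n -> aut T 1)) : aut T n :=
  exist _ (rho_mor x) (rho_iso x).

Definition simple_automorphisms : Prop := forall n, bijective (@rho n).

Definition analytic_theory : Prop :=
  factorization_system structural analytic /\ simple_automorphisms.

Definition rigid_theory : Prop :=
  analytic_theory /\
  forall n (s : 'S_n) (f : hom T n 1),
    analytic f -> f \oc pi_map s = f -> s = 1%g.
End LawvereTheory.

Definition analytic_interpretation T T' (I : interpretation T T') : Prop :=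
  forall n m (f : hom T n m), analytic f -> analytic (imap I f).

Definition RiLT : subcategory LT.
Proof.
refine (@Subcategory _ LT rigid_theory
  (fun T T' I => analytic_interpretation I) _ _).
- by move=> T _ n m f.
- by move=> T T' T'' J I aJ aI n m f af; apply: aJ; apply: aI.
Defined.

(* [same_op x y]: the arities of [x] and [y] are equal, and [x] is [y] up to
   transport along that equality, which is unique since arities are naturals. *)
Definition same_op (O : nat -> Type) m n (x : O m) (y : O n) : Prop :=
  existT O m x = existT O n y.

(* [tagnat.sig1], [tagnat.sig2] and [tagnat.Rank] identify the ordinal
   [\sum_i n i] with the lexicographically ordered set of the pairs <i, r>,
   [r] in [n i]. *)
Section BlockPerm.
Variables (k : nat) (n : 'I_k -> nat) (s : forall i, 'S_(n i)) (t : 'S_k).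

Lemma sum_perm_idx : \sum_i n (t i) = \sum_i n i.
Proof. by rewrite [RHS](reindex_inj (@perm_inj _ t)). Qed.

Definition block_fun (x : 'I_(\sum_i n (t i))) : 'I_(\sum_i n i) :=
  tagnat.Rank (t (tagnat.sig1 x)) (s (t (tagnat.sig1 x)) (tagnat.sig2 x)).

Lemma block_fun_inj : injective (cast_ord (esym sum_perm_idx) \o block_fun).
Proof.
move=> x y /= /cast_ord_inj /(congr1 val) /eqP; rewrite tagnat.eq_Rank.
rewrite (inj_eq perm_inj) => /andP[/eqP e1 /eqP e2].
apply: (can_inj tagnat.sigK); rewrite !tagnat.sigE12.
move: (tagnat.sig1 x) (tagnat.sig2 x) e1 e2 => i a e.
move: (tagnat.sig2 y); case: _ / e => b /val_inj /perm_inj -> //.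
Qed.

(* The permutation <s_1, ..., s_k> * t, which sends <i, r> in
   [\sum_i n (t i)] to <t i, s_(t i) r> in [\sum_i n i]. *)
Definition block_perm : 'S_(\sum_i n (t i)) := perm block_fun_inj.
End BlockPerm.

(* In [op_actM], [(s * t)%g] is the composite of permutations that applies [s]
   first, so this is the law of a left action of the symmetric group. *)
Record operad := Operad {
  op :> nat -> Type;
  op_unit : op 1;
  op_comp : forall k (n : 'I_k -> nat),
    (forall i, op (n i)) -> op k -> op (\sum_i n i);
  op_act : forall n, 'S_n -> op n -> op n;
  op_act1 : forall n (f : op n), op_act 1%g f = f;
  op_actM : forall n (s t : 'S_n) (f : op n),
    op_act (s * t)%g f = op_act t (op_act s f);
  op_comp1 : forall n (f : op n), same_op (op_comp (fun _ : 'I_n => op_unit) f) f;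
  op_1comp : forall n (f : op n), same_op (op_comp (fun _ : 'I_1 => f) op_unit) f;
  op_compA : forall k (n : 'I_k -> nat) (m : forall i, 'I_(n i) -> nat)
      (h : forall i j, op (m i j)) (g : forall i, op (n i)) (f : op k),
    same_op (op_comp (fun i => op_comp (h i) (g i)) f)
      (op_comp (fun l => h (tagnat.sig1 l) (tagnat.sig2 l)) (op_comp g f));
  op_comp_act : forall k (n : 'I_k -> nat) (s : forall i, 'S_(n i)) (t : 'S_k)
      (g : forall i, op (n i)) (f : op k),
    same_op (op_comp (fun i => op_act (s i) (g i)) (op_act t f))
      (op_act (block_perm s t) (op_comp (fun i => g (t i)) f))
}.
Arguments op_unit {O} : rename.
Arguments op_comp {O k n} : rename.
Arguments op_act {O n} : rename.

Record operad_mor (O P : operad) := OperadMor {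
  omap :> forall n, O n -> P n;
  omap_unit : omap op_unit = op_unit;
  omap_comp : forall k (n : 'I_k -> nat) (g : forall i, O (n i)) (f : O k),
    omap (op_comp g f) = op_comp (fun i => omap (g i)) (omap f);
  omap_act : forall n (s : 'S_n) (f : O n), omap (op_act s f) = op_act s (omap f)
}.
Arguments omap {O P} o {n} : rename.

Lemma operad_mor_eq (O P : operad) (h h' : operad_mor O P) :
  (forall n (f : O n), h n f = h' n f) -> h = h'.
Proof.
case: h h' => [h h1 h2 h3] [h' h1' h2' h3'] /= hh'.
have {}hh' : h = h' by apply: functional_extensionality_dep => n; apply: funext.
by subst h'; congr OperadMor; apply: Prop_irrelevance.
Qed.

Definition omor_id (O : operad) : operad_mor O O :=
  @OperadMor O O (fun _ f => f)
    erefl (fun _ _ _ _ => erefl) (fun _ _ _ => erefl).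

Section OperadMorComp.
Variables (O P Q : operad) (h' : operad_mor P Q) (h : operad_mor O P).

Let hh n (f : O n) := omap h' (omap h f).
Let hh_unit : hh op_unit = op_unit.
Proof. by rewrite /hh !omap_unit. Qed.
Let hh_comp k (n : 'I_k -> nat) (g : forall i, O (n i)) (f : O k) :
  hh (op_comp g f) = op_comp (fun i => hh (g i)) (hh f).
Proof. by rewrite /hh !omap_comp. Qed.
Let hh_act n (s : 'S_n) (f : O n) : hh (op_act s f) = op_act s (hh f).
Proof. by rewrite /hh !omap_act. Qed.

Definition omor_comp : operad_mor O Q := OperadMor hh_unit hh_comp hh_act.
End OperadMorComp.

Definition SOp : category operad.
Proof.
by refine (@Category operad operad_mor omor_id omor_comp _ _ _);
   move=> *; apply: operad_mor_eq.
Defined.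

Definition rigid_operad (O : operad) : Prop :=
  forall n (s : 'S_n) (f : O n), op_act s f = f -> s = 1%g.

Definition full_subcategory (Ob : Type) (C : category Ob) (P : Ob -> Prop) :
  subcategory C := @Subcategory Ob C P (fun _ _ _ => True)
    (fun _ _ => I) (fun _ _ _ _ _ _ _ => I).

Definition RiOp : subcategory SOp := @full_subcategory _ SOp rigid_operad.

Definition fiber r m (f : 'I_r -> 'I_m) (i : 'I_m) : {set 'I_r} :=
  [set x | f x == i].

Lemma mem_fiber r m (f : 'I_r -> 'I_m) x : x \in fiber f (f x).
Proof. by rewrite inE. Qed.

(* [enum_val] and [enum_rank_in] identify a fibre with the ordinal of its
   cardinality in an order-preserving way. *)
Definition fiber_perm r m (f : 'I_r -> 'I_m) (s : forall i, 'S_#|fiber f i|)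
    (x : 'I_r) : 'I_r :=
  enum_val (s (f x) (enum_rank_in (mem_fiber f x) x)).

Record span (O : operad) (n m : nat) := Span {
  apex : nat;
  left_leg : 'I_apex -> 'I_n;
  right_leg : 'I_apex -> 'I_m;
  right_mono : {homo right_leg : x y / (x <= y)%N};
  label : forall i, O #|fiber right_leg i|
}.
Arguments Span {O n m apex}.
Arguments left_leg {O n m}.
Arguments right_leg {O n m}.
Arguments label {O n m}.

Variant span_equiv O n m : span O n m -> span O n m -> Prop :=
  SpanEquiv r (phi phi' : 'I_r -> 'I_n) (f : 'I_r -> 'I_m)
    (mono mono' : {homo f : x y / (x <= y)%N})
    (g g' : forall i, O #|fiber f i|) (s : forall i, 'S_#|fiber f i|)
    of (forall i, g i = op_act (s i) (g' i))
    & (forall x, phi (fiber_perm s x) = phi' x) :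
    span_equiv (Span phi f mono g) (Span phi' f mono' g').

Definition op_cast (O : nat -> Type) m n (e : m = n) (x : O m) : O n :=
  ecast k (O k) e x.

Lemma lt_sigP k (n : 'I_k -> nat) (x y : 'I_(\sum_i n i)) : (x < y)%N ->
  (tagnat.sig1 x < tagnat.sig1 y)%N \/
  (tagnat.sig1 x = tagnat.sig1 y /\ (tagnat.sig2 x < tagnat.sig2 y)%N).
Proof.
move=> lt_xy; have: (tagnat.sig x < tagnat.sig y)%O by rewrite tagnat.lt_sig.
rewrite !tagnat.sigE12 Order.SigmaOrder.ltEsig /= !leEord.
move: (tagnat.sig1 x) (tagnat.sig2 x) (tagnat.sig1 y) (tagnat.sig2 y).
move=> i a j b /andP[le_ij]; case: (ltngtP i j) le_ij => //= [ltij _ _|/val_inj eij].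
  by left.
by case: _ / eij in b *; rewrite tagged_asE; right.
Qed.

Lemma lt_Rank k (n : 'I_k -> nat) (i j : 'I_k) (a : 'I_(n i)) (b : 'I_(n j)) :
  (i < j)%N \/ (i = j /\ (a < b)%N) -> (tagnat.Rank i a < tagnat.Rank j b)%N.
Proof.
move=> ltab; suff: (tagnat.Rank i a < tagnat.Rank j b)%O by [].
rewrite /tagnat.Rank tagnat.lt_rank.
rewrite Order.SigmaOrder.ltEsig /= !leEord.
case: ltab => [ltij|[eij]]; first by rewrite (ltnW ltij) leqNgt ltij.
by case: _ / eij in b * => ltab; rewrite tagged_asE leqnn.
Qed.

Lemma sorted_enum_ord M (A : {set 'I_M}) :
  sorted (fun x y : 'I_M => (x < y)%N) (enum A).
Proof.
rewrite {1}/enum_mem -enumT; apply: sorted_filter.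
  by move=> x y z; apply: ltn_trans.
by have := @sorted_map _ _ val ltn (enum 'I_M); rewrite val_enum_ord iota_ltn_sorted.
Qed.

Lemma enum_val_mono M (A : {set 'I_M}) (a b : 'I_#|A|) :
  (a < b)%N -> (enum_val a < enum_val b)%N.
Proof.
move=> ltab; set x0 := enum_val a.
have trans_lt : transitive (fun x y : 'I_M => (x < y)%N).
  by move=> x y z; apply: ltn_trans.
rewrite {1}/x0 !(enum_val_nth x0).
apply: (sorted_ltn_nth trans_lt x0 (sorted_enum_ord A)) => //;
  by rewrite inE -cardE.
Qed.

Lemma mono_enum_val N M (A : {set 'I_M}) (h : 'I_N -> 'I_M) :
    {homo h : x y / (x < y)%N} -> (forall y, h y \in A) ->
  forall (e : N = #|A|) y, enum_val (cast_ord e y) = h y.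
Proof.
move=> mono_h hA e y.
have inj_h : injective h.
  move=> a b hab; apply: val_inj; case: (ltngtP a b) => // /mono_h;
  by rewrite hab ltnn.
have uniq_h : uniq (map h (enum 'I_N)) by rewrite map_inj_uniq ?enum_uniq.
have sub_h : {subset map h (enum 'I_N) <= enum A}.
  by move=> _ /mapP[z _ ->]; rewrite mem_enum.
have size_h : (size (enum A) <= size (map h (enum 'I_N)))%N.
  by rewrite size_map size_enum_ord -cardE e.
have [_ eq_h] := uniq_min_size uniq_h sub_h size_h.
have enum_h : map h (enum 'I_N) = enum A.
  apply: (@irr_sorted_eq _ (fun x y : 'I_M => (x < y)%N)) => //.
  - by move=> a b c; apply: ltn_trans.
  - by move=> a; apply: ltnn.
  - rewrite sorted_map; have := @sorted_map _ _ val ltn (enum 'I_N).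
    rewrite val_enum_ord iota_ltn_sorted => /esym; apply: sub_sorted.
    by move=> a b; apply: mono_h.
  - exact: sorted_enum_ord.
by rewrite (enum_val_nth (h y)) -enum_h (nth_map y) ?size_enum_ord //= nth_ord_enum.
Qed.

Lemma mono_cast_ord N M (h : 'I_N -> 'I_M) :
    {homo h : x y / (x < y)%N} -> forall (e : N = M) y, h y = cast_ord e y.
Proof.
move=> mono_h e y; have eT : N = #|[set: 'I_M]| by rewrite cardsT card_ord.
rewrite -(mono_enum_val mono_h (fun=> in_setT _) eT) //.
by apply: (mono_enum_val (h := cast_ord e)) => // z; rewrite in_setT.
Qed.

(* The pairs <l, x> with [l] in [A], among all pairs. *)
Section SubSum.
Variables (k : nat) (n : 'I_k -> nat) (A : {set 'I_k}).

Definition sub_sum (y : 'I_(\sum_(a < #|A|) n (enum_val a))) : 'I_(\sum_l n l) :=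
  tagnat.Rank (enum_val (tagnat.sig1 y)) (tagnat.sig2 y).

Lemma sub_sum_mono : {homo sub_sum : x y / (x < y)%N}.
Proof.
move=> x y /lt_sigP lt_xy; apply: lt_Rank; case: lt_xy => [lt1|[e1 lt2]].
  by left; apply: enum_val_mono.
by right; split=> [|//]; rewrite e1.
Qed.

Lemma sub_sum_in y : tagnat.sig1 (sub_sum y) \in A.
Proof. by rewrite /sub_sum tagnat.Rank1K enum_valP. Qed.

Lemma card_sub_sum (B : {set 'I_(\sum_l n l)}) :
    (forall x, (x \in B) = (tagnat.sig1 x \in A)) ->
  \sum_(a < #|A|) n (enum_val a) = #|B|.
Proof.
move=> BE; rewrite -[LHS]card_ord -(card_imset _ (f := sub_sum)).
  apply: eq_card => x; rewrite BE; apply/imsetP/idP => [[y _ ->]|xA].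
    exact: sub_sum_in.
  pose a := enum_rank_in xA (tagnat.sig1 x).
  have ea : tagnat.sig1 x = enum_val a by rewrite enum_rankK_in.
  exists (tagnat.Rank a (cast_ord (congr1 n ea) (tagnat.sig2 x))) => //.
  apply: val_inj; rewrite /sub_sum -[in LHS](tagnat.sig2K x).
  apply/eqP; rewrite tagnat.eq_Rank; apply/andP; split.
    by rewrite tagnat.Rank1K -ea.
  by rewrite tagnat.Rank2K.
move=> x y exy; apply: val_inj; case: (ltngtP x y) => // /sub_sum_mono;
by rewrite exy ltnn.
Qed.
End SubSum.

Lemma sig_Rank k (n : 'I_k -> nat) i (a : 'I_(n i)) :
  tagnat.sig (tagnat.Rank i a) = existT (fun i => 'I_(n i)) i a.
Proof. exact: tagnat.rankK. Qed.

Section SpanComp.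
Variables (O : operad) (n m k : nat) (s : span O n m) (s' : span O m k).

(* The pullback of [right_leg s] along [left_leg s']: the pairs <l, x> with
   [right_leg s x = left_leg s' l], ordered lexicographically. *)
Definition pb_apex : nat :=
  \sum_(l < apex s') #|fiber (right_leg s) (left_leg s' l)|.
Definition pb_right (y : 'I_pb_apex) : 'I_(apex s') := tagnat.sig1 y.
Definition pb_left (y : 'I_pb_apex) : 'I_(apex s) := enum_val (tagnat.sig2 y).

Lemma pb_comm y : right_leg s (pb_left y) = left_leg s' (pb_right y).
Proof. by have := enum_valP (tagnat.sig2 y); rewrite inE => /eqP. Qed.

Lemma span_comp_mono : {homo right_leg s' \o pb_right : x y / (x <= y)%N}.
Proof. by move=> x y le_xy; apply/right_mono/tagnat.le_sig1. Qed.

Lemma span_comp_arity j :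
  \sum_(a < #|fiber (right_leg s') j|)
    #|fiber (right_leg s) (left_leg s' (enum_val a))| =
  #|fiber (right_leg s' \o pb_right) j|.
Proof.
apply: (@card_sub_sum _ (fun l => #|fiber (right_leg s) (left_leg s' l)|)).
by move=> x; rewrite !inE.
Qed.

Definition span_comp : span O n k :=
  Span (left_leg s \o pb_left) (right_leg s' \o pb_right) span_comp_mono
    (fun j => op_cast (span_comp_arity j)
      (op_comp (fun a => label s (left_leg s' (enum_val a))) (label s' j))).
End SpanComp.

Lemma card_fiber_id n (i : 'I_n) : 1 = #|fiber id i|.
Proof. by rewrite -(cards1 i); congr #|pred_of_set _|; apply/setP=> x; rewrite !inE. Qed.

Definition span_id O n : span O n n :=
  Span id id (fun _ _ => id) (fun i => op_cast (card_fiber_id i) op_unit).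

Definition span_proj O n (i : 'I_n) : span O n 1 :=
  Span (fun=> i) id (fun _ _ => id)
    (fun j => op_cast (card_fiber_id j) op_unit).

Definition span_map (O P : operad) (h : operad_mor O P) n m (s : span O n m) :
  span P n m :=
  Span (left_leg s) (right_leg s) (@right_mono _ _ _ s)
    (fun i => h _ (label s i)).

(* A span from [n] to [m] amounts to [m] terms in [n] variables, and two spans
   are equivalent iff their terms are, which is how the laws are proved. *)
Section Terms.
Variable O : operad.

Definition term n := {r : nat & (O r * ('I_r -> 'I_n))%type}.
Definition Term n r (g : O r) (phi : 'I_r -> 'I_n) : term n := existT _ r (g, phi).

Lemma Term_inj n r (g g' : O r) (phi phi' : 'I_r -> 'I_n) :
  Term g phi = Term g' phi' -> g = g' /\ phi = phi'.
Proof. by move=> /(@existT_inj2 nat _ _ _ _) -[-> ->]. Qed.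

Lemma term_eq n r r' (g : O r) (g' : O r') (phi : 'I_r -> 'I_n) phi' :
    same_op g g' -> (forall (e : r = r') x, phi x = phi' (cast_ord e x)) ->
  Term g phi = Term g' phi'.
Proof.
move=> gg' pp'; have e := existT_inj1 gg'; subst r'.
rewrite (@existT_inj2 nat _ _ _ _ gg'); congr Term; apply: funext => x.
by rewrite (pp' erefl) cast_ord_id.
Qed.

Definition term_equiv n (t u : term n) : Prop :=
  exists r (g g' : O r) phi phi' (s : 'S_r),
    [/\ t = Term g phi, u = Term g' phi', g = op_act s g' & phi \o s =1 phi'].

Lemma term_equiv_refl n (t : term n) : term_equiv t t.
Proof.
case: t => r [g phi]; exists r, g, g, phi, phi, 1%g; split=> //.
  by rewrite op_act1.
by move=> x /=; rewrite perm1.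
Qed.

Lemma term_equiv_sym n (t u : term n) : term_equiv t u -> term_equiv u t.
Proof.
move=> [r [g [g' [phi [phi' [s [-> -> -> pp']]]]]]].
exists r, g', (op_act s g'), phi', phi, (s^-1)%g; split=> //.
  by rewrite -op_actM mulgV op_act1.
by move=> x /=; rewrite -pp' /= permKV.
Qed.

Lemma term_equiv_trans n (t u v : term n) :
  term_equiv t u -> term_equiv u v -> term_equiv t v.
Proof.
move=> [r [g [g' [phi [phi' [s [-> -> -> pp']]]]]]].
move=> [r1 [g1 [g1' [phi1 [phi1' [s1 [e1 -> eg1 pp1]]]]]]].
have er : r = r1 by exact: existT_inj1 e1.
subst r1; have [eg ep] := Term_inj e1.
exists r, (op_act s g'), g1', phi, phi1', (s1 * s)%g; split=> //.
  by rewrite op_actM -eg1 eg.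
by move=> x /=; rewrite permM -[phi _]/((phi \o s) (s1 x)) pp' ep -pp1.
Qed.

Definition subst n m (t : 'I_m -> term n) (u : term m) : term n :=
  let: existT r (g, psi) := u in
  Term (op_comp (fun a => (projT2 (t (psi a))).1) g)
    (fun y : 'I_(\sum_(a < r) projT1 (t (psi a))) =>
       (projT2 (t (psi (tagnat.sig1 y)))).2 (tagnat.sig2 y)).

Definition var n (i : 'I_n) : term n := Term op_unit (fun=> i).

Lemma subst_equiv n m (t t' : 'I_m -> term n) (u u' : term m) :
    (forall i, term_equiv (t i) (t' i)) -> term_equiv u u' ->
  term_equiv (subst t u) (subst t' u').
Proof.
move=> tt' [r [_ [g [psi [psi' [tau [-> -> -> pp']]]]]]].
have {}pp' : psi' = psi \o tau by apply: funext => x; rewrite pp'.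
subst psi'.
have /choice[R RP] i : exists R : {r : nat & (O r * ('I_r -> 'I_n) * 'S_r)%type},
    t i = Term (op_act (projT2 R).2 (projT2 R).1.1) (projT2 R).1.2 /\
    t' i = Term (projT2 R).1.1 ((projT2 R).1.2 \o (projT2 R).2).
  have [r0 [g0 [g0' [phi [phi' [s [-> -> -> pp]]]]]]] := tt' i.
  exists (existT _ r0 (g0', phi, s)); split=> //=; congr Term.
  by apply: funext => x; rewrite pp.
have -> : t = fun i => Term (op_act (projT2 (R i)).2 (projT2 (R i)).1.1) (projT2 (R i)).1.2.
  by apply: funext => i; case: (RP i).
have -> : t' = fun i => Term (projT2 (R i)).1.1 ((projT2 (R i)).1.2 \o (projT2 (R i)).2).
  by apply: funext => i; case: (RP i).
rewrite /subst /=.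
have := op_comp_act (fun a => (projT2 (R (psi a))).2) tau
  (fun a => (projT2 (R (psi a))).1.1) g.
set c := op_comp _ (op_act _ _); set d := op_comp _ g => cd.
have e := sum_perm_idx (fun a => projT1 (R (psi a))) tau.
set bp := block_perm _ _ in cd.
exists (\sum_(i < r) projT1 (R (psi (tau i)))), (op_act bp d), d,
  (fun y => (projT2 (R (psi (tagnat.sig1 (cast_ord e y))))).1.2 (tagnat.sig2 (cast_ord e y))),
  (fun y => (projT2 (R (psi (tau (tagnat.sig1 y))))).1.2 ((projT2 (R (psi (tau (tagnat.sig1 y))))).2 (tagnat.sig2 y))), bp.
split=> //.
  apply: term_eq => // e' x; have -> : cast_ord e (cast_ord e' x) = x by apply: val_inj.
  by [].
move=> y /=; rewrite /bp permE /= cast_ord_comp cast_ord_id /block_fun.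
by rewrite /tagnat.sig1 /tagnat.sig2 sig_Rank.
Qed.

Lemma subst_var n (u : term n) : subst (@var n) u = u.
Proof.
case: u => r [g phi]; rewrite /subst /=; apply: term_eq; first exact: op_comp1.
move=> e x /=; congr phi.
apply: (@mono_cast_ord _ _ (@tagnat.sig1 r (fun=> 1%N))) => a b /lt_sigP[//|].
by case=> _; rewrite !ord1.
Qed.

Lemma var_subst n m (t : 'I_m -> term n) i : subst t (var i) = t i.
Proof.
rewrite /subst /=; case: (t i) => r [g phi] /=; apply: term_eq => /=.
  exact: op_1comp.
move=> e x; congr phi.
apply: (@mono_cast_ord _ _ (@tagnat.sig2 1 (fun=> r))) => a b /lt_sigP[|[]//].
by rewrite !ord1.
Qed.

Lemma substA n m k (t : 'I_m -> term n) (u : 'I_k -> term m) (v : term k) :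
  subst t (subst u v) = subst (fun i => subst t (u i)) v.
Proof.
case: v => r [g phi].
have -> : (fun i => subst t (u i)) = fun i =>
  Term (op_comp (fun a => (projT2 (t ((projT2 (u i)).2 a))).1) (projT2 (u i)).1)
    (fun y : 'I_(\sum_(a < projT1 (u i)) projT1 (t ((projT2 (u i)).2 a))) =>
       (projT2 (t ((projT2 (u i)).2 (tagnat.sig1 y)))).2 (tagnat.sig2 y)).
  by apply: funext => i; case: (u i) => ? [].
rewrite /subst /=; apply: term_eq => /=.
  apply/esym; exact: (op_compA (fun a b => (projT2 (t ((projT2 (u (phi a))).2 b))).1)
    (fun a => (projT2 (u (phi a))).1) g).
move=> e y.
pose m2 a b := projT1 (t ((projT2 (u (phi a))).2 b)).
pose R (y : 'I_(\sum_(l < \sum_a projT1 (u (phi a))) m2 (tagnat.sig1 l) (tagnat.sig2 l))) :=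
  @tagnat.Rank r (fun a => \sum_b m2 a b) (tagnat.sig1 (tagnat.sig1 y))
    (@tagnat.Rank _ (m2 _) (tagnat.sig2 (tagnat.sig1 y)) (tagnat.sig2 y)).
have -> : cast_ord e y = R y.
  rewrite -(@mono_cast_ord _ _ R) // => a b /lt_sigP lt_ab; apply: lt_Rank.
  move: lt_ab; move: (tagnat.sig2 a) (tagnat.sig2 b).
  move: (tagnat.sig1 a) (tagnat.sig1 b) => {a b} l l' x x' [/lt_sigP|[ell]].
    move: x x'; move: (tagnat.sig2 l) (tagnat.sig2 l').
    move: (tagnat.sig1 l) (tagnat.sig1 l') => {l l'} a b c d x x' [ltab|[eab]].
      by left.
    case: _ / eab in d x' * => ltcd; right; split=> //.
    by apply: lt_Rank; left.
  case: _ / ell in x' * => ltxx; right; split=> //.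
  by apply: lt_Rank; right.
rewrite /R; move: (tagnat.sig1 y) (tagnat.sig2 y) => {}l x.
move: x; move: (tagnat.sig2 l); move: (tagnat.sig1 l) => a b x.
by rewrite /tagnat.sig1 /tagnat.sig2 sig_Rank /= sig_Rank.
Qed.
End Terms.

Section SpanTerms.
Variable O : operad.

Definition span_term n m (s : span O n m) (i : 'I_m) : term O n :=
  Term (label s i) (left_leg s \o enum_val).

Lemma fiber_perm_enum r m (f : 'I_r -> 'I_m) (s : forall i, 'S_#|fiber f i|)
    i (j : 'I_#|fiber f i|) :
  fiber_perm s (enum_val j) = enum_val (s i j).
Proof.
rewrite /fiber_perm; move: (mem_fiber f (enum_val j)).
have := enum_valP j; rewrite inE => /eqP ->.
by move=> H; rewrite enum_valK_in.
Qed.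

Lemma mono_fiber_eq r r' m (f : 'I_r -> 'I_m) (f' : 'I_r' -> 'I_m) :
    {homo f : x y / (x <= y)%N} -> {homo f' : x y / (x <= y)%N} ->
    (forall i, #|fiber f i| = #|fiber f' i|) ->
  map f (enum 'I_r) = map f' (enum 'I_r').
Proof.
have sort_f p (h : 'I_p -> 'I_m) : {homo h : x y / (x <= y)%N} ->
    sorted (fun x y : 'I_m => (x <= y)%N) (map h (enum 'I_p)).
  move=> mono_h; rewrite sorted_map; have := @sorted_map _ _ val leq (enum 'I_p).
  rewrite val_enum_ord iota_sorted => /esym; apply: sub_sorted.
  by move=> a b; apply: mono_h.
have count_f p (h : 'I_p -> 'I_m) i :
    count_mem i (map h (enum 'I_p)) = #|fiber h i|.
  rewrite count_map cardE [in RHS]/enum_mem -enumT size_filter.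
  by apply: eq_count => x; rewrite /= inE.
move=> mono_f mono_f' card_ff'.
apply: (@sorted_eq _ (fun x y : 'I_m => (x <= y)%N)); try exact: sort_f.
- by move=> a b c; apply: leq_trans.
- by move=> a b /anti_leq /val_inj.
by apply/allP => i _ /=; rewrite !count_f card_ff'.
Qed.

Lemma span_equivP n m (s s' : span O n m) :
  span_equiv s s' <-> forall i, term_equiv (span_term s i) (span_term s' i).
Proof.
split=> [[r phi phi' f mono mono' g g' t gg' pp'] i|].
  exists #|fiber f i|, (g i), (g' i), (phi \o enum_val), (phi' \o enum_val), (t i).
  by split=> // j /=; rewrite -pp' fiber_perm_enum.
case: s => r phi f mono g; case: s' => r' phi' f' mono' g' /= H.
have eff : map f (enum 'I_r) = map f' (enum 'I_r').
  apply: mono_fiber_eq => // i.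
  have [k [? [? [? [? [? [e e' _ _]]]]]]] := H i.
  by rewrite (existT_inj1 e) (existT_inj1 e').
have er : r = r' by have := congr1 size eff; rewrite !size_map -!enumT !size_enum_ord.
subst r'; have ef : f = f'.
  by apply: funext => x; apply/eqP; move/eq_in_map: eff => -> //; rewrite mem_enum.
subst f'; have {}H i : exists t : 'S_#|fiber f i|,
    g i = op_act t (g' i) /\ (phi \o enum_val) \o t =1 phi' \o enum_val.
  have [k [g1 [g1' [phi1 [phi1' [t [e e' gg pp]]]]]]] := H i.
  have ek := existT_inj1 e; simpl in ek; subst k.
  have [/= -> ->] := Term_inj e; have [/= -> ->] := Term_inj e'.
  by exists t.
apply: (@SpanEquiv _ _ _ _ _ _ _ _ _ _ _ (fun i => sval (cid (H i)))) => [i|x].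
  by case: cid => t [].
rewrite /fiber_perm; case: cid => t [_ pp] /=.
by have := pp (enum_rank_in (mem_fiber f x) x); rewrite /= enum_rankK_in ?mem_fiber.
Qed.

Lemma span_equiv_refl n m (s : span O n m) : span_equiv s s.
Proof. by apply/span_equivP => i; apply: term_equiv_refl. Qed.

Lemma span_equiv_sym n m (s s' : span O n m) : span_equiv s s' -> span_equiv s' s.
Proof. by move=> /span_equivP H; apply/span_equivP => i; apply: term_equiv_sym. Qed.

Lemma span_equiv_trans n m (s s' s'' : span O n m) :
  span_equiv s s' -> span_equiv s' s'' -> span_equiv s s''.
Proof.
move=> /span_equivP H /span_equivP H'; apply/span_equivP => i.
exact: term_equiv_trans (H i) (H' i).
Qed.

Lemma same_op_cast (P : nat -> Type) m n (e : m = n) (x : P m) :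
  same_op (op_cast e x) x.
Proof. by case: _ / e. Qed.

Lemma span_term_comp n m k (s : span O n m) (s' : span O m k) j :
  span_term (span_comp s s') j = subst (span_term s) (span_term s' j).
Proof.
rewrite /span_term /subst /=; apply/esym/term_eq => /=.
  by apply/esym; apply: same_op_cast.
move=> e y; congr left_leg.
rewrite /pb_left (@mono_enum_val _ _ _
  (@sub_sum _ (fun l => #|fiber (right_leg s) (left_leg s' l)|) _)).
- by rewrite /sub_sum /tagnat.sig1 /tagnat.sig2 sig_Rank.
- exact: sub_sum_mono.
by move=> z; have := @sub_sum_in _ (fun l => #|fiber (right_leg s) (left_leg s' l)|) _ z; rewrite !inE.
Qed.

Lemma span_term_id n i : span_term (span_id O n) i = var O i.
Proof.
apply: term_eq => /=; first exact: same_op_cast.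
by move=> e x; have := enum_valP x; rewrite inE => /eqP.
Qed.

Lemma span_term_proj n (i : 'I_n) j : span_term (span_proj O i) j = var O i.
Proof. by apply: term_eq => //=; apply: same_op_cast. Qed.

Section SpanOf.
Variables (n m : nat) (t : 'I_m -> term O n).

Let ar i := projT1 (t i).

Lemma card_fiber_sig1 i : ar i = #|fiber (@tagnat.sig1 m ar) i|.
Proof.
rewrite -[LHS]card_ord -(card_imset _ (f := @tagnat.Rank m ar i)).
  apply: eq_card => x; apply/imsetP/idP => [[a _ ->]|].
    by rewrite inE tagnat.Rank1K.
  rewrite inE => /eqP ei; case: _ / ei.
  by exists (tagnat.sig2 x); rewrite // tagnat.sig2K.
by move=> a b /tagnat.rank_inj /(@existT_inj2 'I_m _ _ _ _).
Qed.

Definition span_of : span O n m :=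
  Span (fun y : 'I_(\sum_i ar i) => (projT2 (t (tagnat.sig1 y))).2 (tagnat.sig2 y))
    (@tagnat.sig1 m ar) (fun x y => @tagnat.le_sig1 m ar x y)
    (fun i => op_cast (card_fiber_sig1 i) (projT2 (t i)).1).

Lemma span_term_of i : span_term span_of i = t i.
Proof.
case ti : (t i) => [r [g phi]]; rewrite -[RHS]ti.
rewrite /span_term /=.
transitivity (Term (projT2 (t i)).1 (projT2 (t i)).2); last first.
  by case: (t i) => ? [].
apply/esym/term_eq; first by apply/esym; apply: same_op_cast.
move=> e x /=; rewrite (@mono_enum_val _ _ _ (@tagnat.Rank m ar i)).
- by rewrite /tagnat.sig1 /tagnat.sig2 sig_Rank.
- by move=> a b ltab; apply: lt_Rank; right.
by move=> y; rewrite inE tagnat.Rank1K.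
Qed.
End SpanOf.
End SpanTerms.

HB.instance Definition _ O n m := gen_eqMixin (span O n m).
HB.instance Definition _ O n m := gen_choiceMixin (span O n m).

Definition span_rel O n m : rel (span O n m) := fun s s' => `[< span_equiv s s' >].

Lemma span_rel_equiv O n m : equiv_class_of (@span_rel O n m).
Proof.
split.
- by move=> s; apply/asboolP/span_equiv_refl.
- by move=> s s'; apply/asboolP/asboolP => /span_equiv_sym.
- by move=> s' s s'' /asboolP H /asboolP H'; apply/asboolP/(span_equiv_trans H).
Qed.

Canonical span_equiv_rel O n m := EquivRelPack (@span_rel_equiv O n m).

Definition Pa_hom O n m : Type := {eq_quot (@span_rel O n m)}.

Definition span_class O n m (s : span O n m) : Pa_hom O n m :=
  \pi_{eq_quot (@span_rel O n m)} s.
Definition span_repr O n m (A : Pa_hom O n m) : span O n m := repr A.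

Lemma span_reprK O n m (A : Pa_hom O n m) : span_class (span_repr A) = A.
Proof. exact: reprK. Qed.

Lemma span_classP O n m (s s' : span O n m) :
  span_class s = span_class s' <-> span_equiv s s'.
Proof.
by split=> [/eqmodP/asboolP|H]; last by apply/eqmodP/asboolP.
Qed.

Section PaObject.
Variable O : operad.

Definition Pa_id n : Pa_hom O n n := span_class (span_id O n).
(* The choice of representatives is immaterial, by [Pa_comp_class]. *)
Definition Pa_comp n m k (B : Pa_hom O m k) (A : Pa_hom O n m) : Pa_hom O n k :=
  span_class (span_comp (span_repr A) (span_repr B)).

Definition hom_term n m (A : Pa_hom O n m) (i : 'I_m) : term O n :=
  span_term (span_repr A) i.

Lemma hom_term_class n m (s : span O n m) i :
  term_equiv (hom_term (span_class s) i) (span_term s i).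
Proof. by move: i; apply/span_equivP/span_classP; rewrite span_reprK. Qed.

Lemma Pa_hom_eq n m (A B : Pa_hom O n m) :
  (forall i, term_equiv (hom_term A i) (hom_term B i)) -> A = B.
Proof. by move=> AB; rewrite -[A]span_reprK -[B]span_reprK; apply/span_classP/span_equivP. Qed.

Lemma hom_term_comp n m k (B : Pa_hom O m k) (A : Pa_hom O n m) j :
  term_equiv (hom_term (Pa_comp B A) j) (subst (hom_term A) (hom_term B j)).
Proof. by rewrite -span_term_comp; apply: hom_term_class. Qed.

Lemma hom_term_id n i : term_equiv (hom_term (Pa_id n) i) (var O i).
Proof. by rewrite -(span_term_id O i); apply: hom_term_class. Qed.

Lemma Pa_comp_class n m k (s' : span O m k) (s : span O n m) :
  Pa_comp (span_class s') (span_class s) = span_class (span_comp s s').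
Proof.
apply/span_classP/span_equivP => j; rewrite !span_term_comp.
by apply: subst_equiv => [i|]; apply: hom_term_class.
Qed.

Lemma Pa_comp1m n m (A : Pa_hom O n m) : Pa_comp (Pa_id m) A = A.
Proof.
apply: Pa_hom_eq => j; apply: term_equiv_trans (hom_term_comp _ _ _) _.
rewrite -[hom_term A j in X in term_equiv _ X]var_subst.
by apply: subst_equiv (hom_term_id _) => i; apply: term_equiv_refl.
Qed.

Lemma Pa_compm1 n m (A : Pa_hom O n m) : Pa_comp A (Pa_id n) = A.
Proof.
apply: Pa_hom_eq => j; apply: term_equiv_trans (hom_term_comp _ _ _) _.
rewrite -[X in term_equiv _ X]subst_var.
by apply: subst_equiv (term_equiv_refl _) => i; apply: hom_term_id.
Qed.

Lemma Pa_compA n m k l (D : Pa_hom O k l) (B : Pa_hom O m k) (A : Pa_hom O n m) :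
  Pa_comp D (Pa_comp B A) = Pa_comp (Pa_comp D B) A.
Proof.
apply: Pa_hom_eq => j; apply: term_equiv_trans (hom_term_comp _ _ _) _.
apply: term_equiv_sym; apply: term_equiv_trans (hom_term_comp _ _ _) _.
apply: term_equiv_trans (_ : term_equiv _ (subst (hom_term A) (subst (hom_term B) (hom_term D j)))) _.
  by apply: subst_equiv (hom_term_comp _ _ _) => i; apply: term_equiv_refl.
rewrite substA; apply: subst_equiv (term_equiv_refl _) => i.
exact: term_equiv_sym (hom_term_comp _ _ _).
Qed.

Definition Pa_cat : category nat := Category Pa_comp1m Pa_compm1 Pa_compA.

Definition Pa_proj n (i : 'I_n) : hom Pa_cat n 1 := span_class (span_proj O i).

Lemma hom_term_proj n m (u : hom Pa_cat m n) (i : 'I_n) j :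
  term_equiv (hom_term (Pa_proj i \oc u) j) (hom_term u i).
Proof.
apply: term_equiv_trans (hom_term_comp _ _ _) _; rewrite -[X in term_equiv _ X]var_subst.
apply: subst_equiv => [k|]; first exact: term_equiv_refl.
by rewrite -(span_term_proj O i j); apply: hom_term_class.
Qed.

Lemma Pa_proj_prod m n (t : 'I_n -> hom Pa_cat m 1) :
  exists! u : hom Pa_cat m n, forall i, Pa_proj i \oc u = t i.
Proof.
exists (span_class (span_of (fun i => hom_term (t i) ord0))); split=> [i|u ut].
  apply: Pa_hom_eq => j; rewrite [j]ord1.
  apply: term_equiv_trans (hom_term_proj _ _ _) _.
  by rewrite -[X in term_equiv _ X](span_term_of (fun i => hom_term (t i) ord0));
     apply: hom_term_class.
apply: Pa_hom_eq => i; apply: term_equiv_trans (hom_term_class _ _) _.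
by rewrite span_term_of -ut; apply: hom_term_proj.
Qed.

Lemma Pa_proj_id1 : Pa_proj (ord0 : 'I_1) = idm Pa_cat 1.
Proof.
by apply/span_classP/span_equivP => j; rewrite span_term_proj span_term_id [j]ord1;
   apply: term_equiv_refl.
Qed.

Definition Pa_ob : lawvere := Lawvere Pa_proj_prod Pa_proj_id1.
End PaObject.

Section PaMorphism.
Variables (O P : operad) (h : operad_mor O P).

Definition Pa_map n m (A : hom (Pa_ob O) n m) : hom (Pa_ob P) n m :=
  span_class (span_map h (span_repr A)).

Lemma span_map_equiv n m (s s' : span O n m) :
  span_equiv s s' -> span_equiv (span_map h s) (span_map h s').
Proof.
case=> r phi phi' f mono mono' g g' t gg' pp'.
by apply: (SpanEquiv _ _ (s := t)) => // i; rewrite /= gg' omap_act.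
Qed.

Lemma Pa_map_class n m (s : span O n m) :
  Pa_map (span_class s) = span_class (span_map h s).
Proof. by apply/span_classP/span_map_equiv/span_classP; rewrite span_reprK. Qed.

Lemma omap_cast m n (e : m = n) (f : O m) : h n (op_cast e f) = op_cast e (h m f).
Proof. by case: _ / e. Qed.

Lemma span_map_eq n m r (phi : 'I_r -> 'I_n) (f : 'I_r -> 'I_m) mono mono'
    (g g' : forall i, P #|fiber f i|) :
  (forall i, g i = g' i) -> Span phi f mono g = Span phi f mono' g'.
Proof.
move=> gg'; rewrite (Prop_irrelevance mono mono'); congr Span.
exact: functional_extensionality_dep.
Qed.

Lemma Pa_map_id n : Pa_map (idm (Pa_ob O) n) = idm (Pa_ob P) n.
Proof.
rewrite [LHS]Pa_map_class; congr span_class; apply: span_map_eq => i.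
by rewrite omap_cast omap_unit.
Qed.

Lemma Pa_map_comp n m k (B : hom (Pa_ob O) m k) (A : hom (Pa_ob O) n m) :
  Pa_map (B \oc A) = Pa_map B \oc Pa_map A.
Proof.
rewrite [LHS]Pa_map_class [RHS]Pa_comp_class.
apply: (congr1 (@span_class _ _ _)).
by apply: span_map_eq => i; rewrite /= omap_cast omap_comp; congr op_cast; apply: eq_irrelevance.
Qed.

Lemma Pa_map_proj n (i : 'I_n) : Pa_map (proj (Pa_ob O) i) = proj (Pa_ob P) i.
Proof.
rewrite [LHS]Pa_map_class; congr span_class; apply: span_map_eq => j.
by rewrite omap_cast omap_unit.
Qed.

Definition Pa_mor : interpretation (Pa_ob O) (Pa_ob P) :=
  Interpretation Pa_map_id Pa_map_comp Pa_map_proj.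
End PaMorphism.

Lemma Pa_mor_id O : Pa_mor (omor_id O) = interp_id (Pa_ob O).
Proof.
apply: interpretation_eq => n m f; rewrite -[f]span_reprK [LHS]Pa_map_class.
by congr span_class; case: (span_repr f).
Qed.

Lemma Pa_mor_comp O P Q (h' : operad_mor P Q) (h : operad_mor O P) :
  Pa_mor (omor_comp h' h) = interp_comp (Pa_mor h') (Pa_mor h).
Proof.
apply: interpretation_eq => n m f.
by rewrite [RHS]Pa_map_class.
Qed.

Definition Pa : functor SOp LT :=
  @Functor _ _ SOp LT Pa_ob Pa_mor Pa_mor_id Pa_mor_comp.

Definition Pp : functor (subcat RiOp) LT := functor_comp Pa (subcat_incl RiOp).

(* Main.v *)
From mathcomp Require Import all_boot all_order all_fingroup.
From mathcomp Require Import boolp.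
Require Import Defs.

(* Let [O] be a rigid operad. A morphism [n -> 1] of [Pa O] is [g o pi_phi] with
   [g] an operation, and [g] is right orthogonal to every [pi_phi] because a
   renaming of variables fixing [g] is trivial, the actions being free. Hence a
   morphism is analytic iff the renaming in such a decomposition is bijective:
   [Pa O] is rigid, [Pa h] preserves analytic morphisms, and an analytic
   interpretation [Pa O -> Pa P] restricts to an operad morphism [O -> P].
   Conversely, in a rigid theory [T] the analytic morphisms [n -> 1] form a rigid
   operad. Since [T] has simple automorphisms, isomorphic objects are equal and a
   structural morphism is some [pi_phi] followed by an isomorphism, so that every
   [n -> 1] is [a o pi_phi] with [a] analytic, uniquely up to a permutation; thus
   [T] is isomorphic to the theory of its operad. Finally rigidity is invariant
   under isomorphism of theories, and isomorphisms are analytic. *)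

Set Implicit Arguments.
Unset Strict Implicit.
Unset Printing Implicit Defensive.

(** * Orthogonality *)

Section Orthogonality.
Variables (Ob : Type) (C : category Ob).

Lemma inverse_of_is_iso x y (f : hom C x y) (g : hom C y x) :
  inverse_of f g -> is_iso g.
Proof. by case=> gf fg; exists f; split. Qed.

Lemma is_iso_monic x y z (f : hom C y z) (g h : hom C x y) :
  is_iso f -> f \oc g = f \oc h -> g = h.
Proof.
by move=> [f' [f'f _]] /(congr1 (comp f')); rewrite !compA f'f !comp1m.
Qed.

Lemma arrow_iso_trans x y x1 y1 x2 y2
    (f : hom C x y) (f1 : hom C x1 y1) (f2 : hom C x2 y2) :
  arrow_iso f f1 -> arrow_iso f1 f2 -> arrow_iso f f2.
Proof.
move=> [i [j [iI jI e]]] [i1 [j1 [i1I j1I e1]]].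
exists (i1 \oc i), (j1 \oc j); split; try exact: is_iso_comp.
by rewrite -compA e compA e1 compA.
Qed.

Lemma iso_closure_iso_closed (K : mor_class C) : iso_closed (iso_closure K).
Proof.
move=> x y x' y' f f' ff' [x0 [y0 [f0 [Kf0 f0f]]]].
by exists x0, y0, f0; split=> //; apply: arrow_iso_trans ff'.
Qed.

Lemma sub_iso_closure (K : mor_class C) x y (f : hom C x y) :
  K x y f -> iso_closure K f.
Proof.
move=> Kf; exists x, y, f; split=> //; exists (idm C x), (idm C y).
by split; rewrite ?comp1m ?compm1 //; apply: is_iso_id.
Qed.

Lemma orthogonalI x y z t (s : hom C x y) (a : hom C z t) :
    (forall u v, a \oc u = v \oc s -> exists d,
      [/\ d \oc s = u, a \oc d = v & forall d', d' \oc s = u -> a \oc d' = v -> d' = d]) ->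
  orthogonal s a.
Proof.
move=> saP u v /saP[d [ds ad d_uniq]]; exists d; split=> // d' [d's ad'].
exact/esym/d_uniq.
Qed.

(** A square over [s'] becomes a square over [s] after composing with [i] and [j], and its diagonal
    is carried back along [j']. *)
Lemma orthogonal_arrow_iso x y x' y' z t (s : hom C x y) (s' : hom C x' y')
    (a : hom C z t) :
  arrow_iso s s' -> orthogonal s a -> orthogonal s' a.
Proof.
move=> [i [j [[i' [i'i ii']] [j' [j'j jj']] e]]] sa u v e1.
have e2 : a \oc (u \oc i) = v \oc j \oc s.
  by rewrite compA e1 -[in RHS]compA e compA.
have [d [[ds ad] d_uniq]] := sa _ _ e2.
have s'E : s' = j \oc s \oc i' by rewrite e -compA ii' compm1.
exists (d \oc j'); split.
  split; last by rewrite compA ad -compA jj' compm1.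
  by rewrite s'E !compA -(compA d) j'j compm1 ds -compA ii' compm1.
move=> d1 [d1s ad1]; rewrite -[d1]compm1 -jj' compA; congr (_ \oc _).
apply: d_uniq; split; last by rewrite compA ad1.
by rewrite -compA e compA d1s.
Qed.

Lemma right_orthogonal_closure (K : mor_class C) z t (a : hom C z t) :
    (forall x y (s : hom C x y), K x y s -> orthogonal s a) ->
  right_orthogonal (iso_closure K) a.
Proof.
move=> Ka x y s [x0 [y0 [s0 [Ks0 s0s]]]].
exact: orthogonal_arrow_iso s0s (Ka _ _ _ Ks0).
Qed.

Variable K : mor_class C.

Lemma right_orthogonal_iso z t (a : hom C z t) : is_iso a -> right_orthogonal K a.
Proof.
move=> aI; have [a' [a'a aa']] := aI; move=> x y s _ u v e; exists (a' \oc v); split.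
  by rewrite -compA -e !compA a'a aa' !comp1m.
by move=> d [_ <-]; rewrite compA a'a comp1m.
Qed.

Lemma right_orthogonal_comp z t w (b : hom C t w) (a : hom C z t) :
  right_orthogonal K b -> right_orthogonal K a -> right_orthogonal K (b \oc a).
Proof.
move=> bK aK x y s Ks u v; rewrite -compA => e.
have [d [[ds bd] d_uniq]] := bK _ _ _ Ks _ _ e.
have [c [[cs ac] c_uniq]] := aK _ _ _ Ks _ _ (esym ds).
exists c; split; first by rewrite -compA ac.
move=> c1 [c1s bac1]; apply: c_uniq; split=> //; apply/esym/d_uniq.
by rewrite -compA c1s compA.
Qed.

Lemma right_orthogonal_iso_closed : iso_closed (right_orthogonal K).
Proof.
move=> x y x' y' f f' [i [j [[i' i'P] jI e]]] fK.
have -> : f' = j \oc f \oc i' by rewrite e -compA (proj2 i'P) compm1.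
apply: right_orthogonal_comp; last first.
  exact/right_orthogonal_iso/(inverse_of_is_iso i'P).
by apply: right_orthogonal_comp fK; apply: right_orthogonal_iso.
Qed.

(** Lifting each factorization against the other gives [d] and [d']; their composites solve lifting
    problems that identities also solve. *)
Lemma factorization_unique x y y' z (s : hom C x y) (a : hom C y z)
    (s' : hom C x y') (a' : hom C y' z) :
    K s -> K s' -> right_orthogonal K a -> right_orthogonal K a' ->
    a \oc s = a' \oc s' ->
  exists d : hom C y y', [/\ is_iso d, d \oc s = s' & a' \oc d = a].
Proof.
move=> Ks Ks' aK a'K e.
have [d [[ds a'd] _]] := a'K _ _ _ Ks _ _ (esym e).
have [d' [[d's' ad'] _]] := aK _ _ _ Ks' _ _ e.
have eq_id w (t : hom C x w) (b : hom C w z) (c : hom C w w) :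
    K t -> right_orthogonal K b -> c \oc t = t -> b \oc c = b -> c = idm C w.
  move=> Kt bK ct bc; have [c0 [_ c0_uniq]] := bK _ _ _ Kt _ _ (erefl (b \oc t)).
  by apply: (etrans (esym (c0_uniq c _)) (c0_uniq _ _)); rewrite ?comp1m ?compm1.
exists d; split=> //; exists d'; split.
  by apply: (eq_id _ s a) => //; [rewrite -compA ds | rewrite compA ad'].
by apply: (eq_id _ s' a') => //; [rewrite -compA d's' | rewrite compA a'd].
Qed.

(** The identity followed by [a \oc s], and [s] followed by [a], factor the same morphism; the
    comparison isomorphism between them is [s]. *)
Lemma right_orthogonal_cancel x y z (s : hom C x y) (a : hom C y z) :
    K s -> right_orthogonal K a -> right_orthogonal K (a \oc s) ->
  K (idm C x) -> is_iso s.
Proof.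
move=> Ks aK asK K1.
have e : a \oc s \oc idm C x = a \oc s by rewrite compm1.
have [d [dI <- _]] := factorization_unique K1 Ks asK aK e.
by rewrite compm1.
Qed.

End Orthogonality.

(** * Lawvere theories *)

Section LawvereTheories.
Variable T : lawvere.
Implicit Types n m k : nat.

Lemma tupling_comp n m k (t : 'I_k -> hom T m 1) (u : hom T n m) :
  tupling t \oc u = tupling (fun i => t i \oc u).
Proof. by apply: proj_inj => i; rewrite compA !proj_tupling. Qed.

Lemma tupling_proj n m (u : hom T n m) : tupling (fun i => proj T i \oc u) = u.
Proof. by apply: proj_inj => i; rewrite proj_tupling. Qed.

Lemma tupling1 n (u : hom T n 1) : tupling (fun=> u) = u.
Proof.
by apply: proj_inj => i; rewrite proj_tupling [i]ord1 proj_id1 comp1m.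
Qed.

Lemma proj_pi_map n m (phi : 'I_m -> 'I_n) i :
  proj T i \oc pi_map T phi = proj T (phi i).
Proof. exact: proj_tupling. Qed.

Lemma pi_map_tupling n m k (phi : 'I_k -> 'I_m) (t : 'I_m -> hom T n 1) :
  pi_map T phi \oc tupling t = tupling (fun i => t (phi i)).
Proof. by rewrite tupling_comp; congr tupling; apply: funext => i; rewrite proj_tupling. Qed.

Lemma pi_map_comp n m k (phi : 'I_k -> 'I_m) (psi : 'I_m -> 'I_n) :
  pi_map T phi \oc pi_map T psi = pi_map T (psi \o phi).
Proof. exact: pi_map_tupling. Qed.

Lemma pi_map_id n : pi_map T (@id 'I_n) = idm T n.
Proof. by apply: proj_inj => i; rewrite proj_pi_map compm1. Qed.

Lemma pi_map1 n (i : 'I_n) : pi_map T (fun _ : 'I_1 => i) = proj T i.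
Proof. exact: tupling1. Qed.

Lemma pi_map_bij_iso n m (phi : 'I_m -> 'I_n) : bijective phi -> is_iso (pi_map T phi).
Proof.
move=> [psi phiK psiK]; exists (pi_map T psi); rewrite /inverse_of !pi_map_comp -!pi_map_id.
by split; congr pi_map; apply: funext.
Qed.

Lemma prod_map_pi_map n k (phi : 'I_k -> 'I_n) (a : 'I_n -> hom T 1 1) :
  pi_map T phi \oc prod_map a = prod_map (a \o phi) \oc pi_map T phi.
Proof.
by apply: proj_inj => i; rewrite !compA proj_pi_map !proj_tupling -compA proj_pi_map.
Qed.

Lemma prod_map_comp n (a b : 'I_n -> hom T 1 1) :
  prod_map a \oc prod_map b = prod_map (fun i => a i \oc b i).
Proof.
by apply: proj_inj => i; rewrite compA !proj_tupling -compA proj_tupling compA.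
Qed.

Lemma prod_map_iso n (a : 'I_n -> hom T 1 1) :
  (forall i, is_iso (a i)) -> is_iso (prod_map a).
Proof.
have id1 : prod_map (fun=> idm T 1) = idm T n.
  by apply: proj_inj => i; rewrite proj_tupling comp1m compm1.
move=> aI; have /choice[b bP] i : exists g, inverse_of (a i) g by apply: aI.
exists (prod_map b); split; rewrite prod_map_comp -id1;
  by congr prod_map; apply: funext => i; case: (bP i).
Qed.

Lemma structural_pi_map n m (phi : 'I_m -> 'I_n) : structural (pi_map T phi).
Proof. by apply: sub_iso_closure; exists phi. Qed.

Lemma structural_id n : structural (idm T n).
Proof. by rewrite -pi_map_id; apply: structural_pi_map. Qed.

Lemma analytic_iso n m (f : hom T n m) : is_iso f -> analytic f.
Proof. exact: right_orthogonal_iso. Qed.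

Lemma analytic_comp n m k (g : hom T m k) (f : hom T n m) :
  analytic g -> analytic f -> analytic (g \oc f).
Proof. exact: right_orthogonal_comp. Qed.

(** Every structural morphism is conjugate to a renaming, and lifting is invariant under
    conjugation. *)
Lemma analyticP n m (f : hom T n m) :
    (forall k l (phi : 'I_l -> 'I_k), orthogonal (pi_map T phi) f) ->
  analytic f.
Proof. by move=> fP; apply: right_orthogonal_closure => k l _ [phi ->]. Qed.

Lemma analytic_pi_map_iso n m k (a : hom T m k) (phi : 'I_m -> 'I_n) :
  analytic a -> analytic (a \oc pi_map T phi) -> is_iso (pi_map T phi).
Proof.
move=> aA aphiA; apply: right_orthogonal_cancel aA aphiA _.
  exact: structural_pi_map.
exact: structural_id.
Qed.

(** This is the product [g_1 x ... x g_k]; composing an operation of arity [k] with it is operadic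
    composition. *)
Definition prod_block k (n : 'I_k -> nat) (g : forall i, hom T (n i) 1) :
    hom T (\sum_i n i) k :=
  tupling (fun i => g i \oc pi_map T (tagnat.Rank i)).

Lemma eq_prod_block k (n : 'I_k -> nat) (g g' : forall i, hom T (n i) 1) :
  (forall i, g i = g' i) -> prod_block g = prod_block g'.
Proof. by move=> gg'; congr tupling; apply: funext => i; rewrite gg'. Qed.

(** A lifting problem against a product splits into one for each factor, and the unique diagonals
    are reassembled by the universal property. *)
Lemma prod_block_analytic k (n : 'I_k -> nat) (g : forall i, hom T (n i) 1) :
  (forall i, analytic (g i)) -> analytic (prod_block g).
Proof.
move=> gA; move=> x y s sS u v e.
have ei i : g i \oc (pi_map T (tagnat.Rank i) \oc u) = proj T i \oc v \oc s.
  by rewrite -compA -e [in RHS]compA proj_tupling compA.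
have [d dP] : {d : forall i, hom T y (n i) | forall i, unique (fun d : hom T y (n i) =>
    d \oc s = pi_map T (tagnat.Rank i) \oc u /\ g i \oc d = proj T i \oc v) (d i)}.
  exists (fun i => sval (cid (gA i _ _ _ sS _ _ (ei i)))) => i.
  exact: svalP (cid (gA i _ _ _ sS _ _ (ei i))).
exists (tupling (fun l => proj T (tagnat.sig2 l) \oc d (tagnat.sig1 l))).
have RankE i : pi_map T (tagnat.Rank i) \oc
    tupling (fun l => proj T (tagnat.sig2 l) \oc d (tagnat.sig1 l)) = d i.
  rewrite pi_map_tupling -[RHS]tupling_proj; congr tupling; apply: funext => j.
  by rewrite /tagnat.sig1 /tagnat.sig2 sig_Rank.
split.
  split.
    apply: proj_inj => l; rewrite compA proj_tupling -compA.
    case: (dP (tagnat.sig1 l)) => -[-> _] _; rewrite compA proj_pi_map.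
    by rewrite tagnat.sig2K.
  apply: proj_inj => i; rewrite compA proj_tupling -compA RankE.
  by case: (dP i) => -[].
move=> d1 [d1s gd1]; apply: proj_inj => l; rewrite proj_tupling.
have -> : d (tagnat.sig1 l) = pi_map T (tagnat.Rank (tagnat.sig1 l)) \oc d1.
  case: (dP (tagnat.sig1 l)) => _; apply.
  by rewrite -compA d1s -gd1 !compA proj_tupling.
by rewrite compA proj_pi_map tagnat.sig2K.
Qed.

End LawvereTheories.

(** * Theories with simple automorphisms *)

Section SimpleAutomorphisms.
Variable T : lawvere.
Implicit Types n m k : nat.

(** Failure of this condition makes all parallel morphisms equal, since any two morphisms into [1]
    are the components of one morphism into [2]. *)
Definition nondegenerate := proj T (ord0 : 'I_2) <> proj T (ord_max : 'I_2).

Lemma nondegenerate_proj_eq n (i j : 'I_n) (a b : hom T 1 1) :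
  nondegenerate -> is_iso a -> a \oc proj T i = b \oc proj T j -> i = j.
Proof.
move=> ndT aI e; apply/eqP/negPn/negP => neq_ij; apply: ndT.
apply: (is_iso_monic aI).
have e1 (phi : 'I_n -> 'I_2) : a \oc proj T (phi i) = b \oc proj T (phi j).
  by rewrite -!proj_pi_map !compA e.
(* The constant renaming replaces [a] by [b] on the last variable; the renaming that separates [i]
   from all other indices then closes the goal. *)
have := e1 (fun=> ord_max); rewrite /= => ->.
have := e1 (fun l => if l == i then ord0 else ord_max).
by rewrite eqxx eq_sym (negbTE neq_ij).
Qed.

(** The diagonal [1 -> n] is a section of every projection. *)
Lemma proj_epic n (i : 'I_n) (a b : hom T 1 1) :
  a \oc proj T i = b \oc proj T i -> a = b.
Proof.
move=> /(congr1 (fun u => u \oc tupling (fun=> idm T 1))).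
by rewrite -!compA proj_tupling !compm1.
Qed.

(** In a degenerate theory the identity and the transposition give the same automorphism of [2],
    against injectivity of [rho]. *)
Lemma simple_nondegenerate : simple_automorphisms T -> nondegenerate.
Proof.
move=> /(_ 2)/bij_inj rho_inj eT.
have all_eq n (f g : hom T n 1) : f = g.
  pose t (i : 'I_2) := if i == ord0 then f else g.
  by rewrite -[f]/(t ord0) -[g]/(t ord_max) -!(proj_tupling t) eT.
pose a (i : 'I_2) : aut T 1 := exist _ (idm T 1) (is_iso_id _ _).
have /rho_inj : rho (1%g, a) = rho (tperm ord0 ord_max, a).
  by apply: sval_inj; apply: proj_inj => i; apply: all_eq.
by case=> /(congr1 (fun s : 'S_2 => s ord0)); rewrite perm1 tpermL.
Qed.

Lemma rho_morE n (x : 'S_n * ('I_n -> aut T 1)) i :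
  proj T i \oc rho_mor x = sval (x.2 i) \oc proj T (x.1 i).
Proof. by rewrite compA proj_tupling -compA proj_pi_map. Qed.

(** Component [i] of [rho_mor (s, a)] is [a i] applied to the variable [s i]. Nondegeneracy lets
    both be read off, so it gives injectivity of [rho] and leaves only surjectivity to check. *)
Lemma simple_automorphismsP :
  simple_automorphisms T <->
  nondegenerate /\
  forall n (f : hom T n n), is_iso f -> exists x, f = rho_mor (n := n) x.
Proof.
split=> [sT|[ndT rhoT] n].
  split=> [|n f fI]; first exact: simple_nondegenerate.
  have [g _ gK] := sT n.
  by exists (g (exist _ f fI)); rewrite -[rho_mor _]/(sval (rho (g _))) gK.
have /choice[g gP] : forall f : aut T n, exists x, sval f = rho_mor x.
  by case=> f fI; apply: rhoT.
exists g => [x|f]; last by apply/esym/sval_inj/gP.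
have {gP} := gP (rho x); move: (g _) => y /=; case: x y => [s a] [s' a'] e.
have {}e i : sval (a i) \oc proj T (s i) = sval (a' i) \oc proj T (s' i).
  by have := congr1 (comp (proj T i)) e; rewrite !rho_morE.
have ess' i : s i = s' i by apply: nondegenerate_proj_eq (e i) => //; case: (a i).
congr (_, _); first by apply/permP => i; rewrite ess'.
apply: funext => i; apply/esym/sval_inj.
by apply: (@proj_epic _ (s i)); rewrite e ess'.
Qed.

Hypothesis simpleT : simple_automorphisms T.

(* For mutually inverse [f : n -> m] and [g], the involution
   [(x, y) |-> (g y, f x)] of [n + m] must be of the form [rho_mor (s, a)];
   then [s] maps the last [m] indices injectively to the first [n]. *)
Lemma inverse_leq n m (f : hom T n m) (g : hom T m n) :
  inverse_of f g -> (m <= n)%N.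
Proof.
move=> [gf fg].
have [ndT rhoT] := proj1 simple_automorphismsP simpleT.
pose px := pi_map T (@lshift n m); pose py := pi_map T (@rshift n m).
pose w := tupling (fun l : 'I_(n + m) => match split l with
  | inl i => proj T i \oc (g \oc py) | inr j => proj T j \oc (f \oc px) end).
have wl i : proj T (lshift m i) \oc w = proj T i \oc (g \oc py).
  by rewrite proj_tupling -[lshift m i]/(unsplit (inl i)) unsplitK.
have wr j : proj T (rshift n j) \oc w = proj T j \oc (f \oc px).
  by rewrite proj_tupling -[rshift n j]/(unsplit (inr j)) unsplitK.
have pxw : px \oc w = g \oc py.
  by apply: proj_inj => i; rewrite compA proj_pi_map wl.
have pyw : py \oc w = f \oc px.
  by apply: proj_inj => j; rewrite compA proj_pi_map wr.
have ww : w \oc w = idm T (n + m).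
  apply: proj_inj => l; rewrite compm1 compA -[l]splitK; case: (split l) => i /=.
    by rewrite wl -!compA pyw (compA g) gf comp1m proj_pi_map.
  by rewrite wr -!compA pxw (compA f) fg comp1m proj_pi_map.
have [[s a] wE] : exists x, w = rho_mor x by apply: rhoT; exists w.
have sP j : exists c, s (rshift n j) = lshift m c.
  have := wr j; rewrite wE rho_morE /=; move: (s _) => l; rewrite -[l]splitK.
  case: (split l) => [c _|c /= e]; first by exists c.
  case: ndT; case: (a (rshift n j)) e => b bI /= e; apply: (is_iso_monic bI).
  (* Here [b] applied to a variable of the second block equals a morphism that reads only the first
     block. Hence the choice of [i], to which [phi] renames the second block, has no effect. *)
  pose phi (i : 'I_2) (l : 'I_(n + m)) := if split l is inl _ then ord0 else i.
  have e1 i : b \oc proj T i = proj T j \oc (f \oc pi_map T (fun=> ord0 : 'I_2)).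
    transitivity (b \oc proj T (rshift n c) \oc pi_map T (phi i)).
      by rewrite -compA proj_pi_map /phi -[rshift n c]/(unsplit (inr c)) unsplitK.
    rewrite e -!compA pi_map_comp; congr (_ \oc (_ \oc pi_map _ _)).
    by apply: funext => x; rewrite /phi /= -[lshift m x]/(unsplit (inl x)) unsplitK.
  by rewrite !e1.
have /choice[c cP] := sP.
rewrite -[m]card_ord -[n]card_ord; apply: (@leq_card _ _ c) => j j' ecj.
by apply: (@rshift_inj n m); apply: (@perm_inj _ s); rewrite !cP ecj.
Qed.

Lemma is_iso_eq n m (f : hom T n m) : is_iso f -> n = m.
Proof.
move=> [g [gf fg]]; apply/eqP; rewrite eqn_leq; apply/andP; split.
  by apply: (@inverse_leq _ _ g f).
by apply: (@inverse_leq _ _ f g).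
Qed.

(** Isomorphic objects being equal, the isomorphism on the source is a renaming followed by a
    product of unary isomorphisms; by [prod_map_pi_map] that product slides past [pi_map phi] to the
    target side. *)
Lemma structuralP n m (s : hom T n m) : structural s ->
  exists (j : hom T m m) (psi : 'I_m -> 'I_n), is_iso j /\ s = j \oc pi_map T psi.
Proof.
move=> [x [y [_ [[phi ->] [i [j [[i' iV] jI e]]]]]]].
have ? := is_iso_eq jI; subst y.
have i'I := inverse_of_is_iso iV; have ? := is_iso_eq i'I; subst x.
have [_ rhoT] := proj1 simple_automorphismsP simpleT.
have [[t a] i'E] := rhoT _ _ i'I.
exists (j \oc prod_map (fun l => sval (a (phi l)))), (t \o phi); split.
  apply: is_iso_comp jI _; apply: prod_map_iso => l; exact: svalP (a (phi l)).
rewrite -[s]compm1 -(proj2 iV) compA -e i'E /rho_mor /= -!compA; congr (_ \oc _).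
by rewrite compA prod_map_pi_map -compA pi_map_comp.
Qed.

(** The comparison isomorphism [d] has the form [rho_mor (s, b)]. Since it carries one renaming to
    another, each [b i] is the identity, so [d] is itself a renaming. *)
Lemma analytic_factor_unique n m r r' (a : hom T r m) (a' : hom T r' m)
    (psi : 'I_r -> 'I_n) (psi' : 'I_r' -> 'I_n) :
    analytic a -> analytic a' -> a \oc pi_map T psi = a' \oc pi_map T psi' ->
  exists s : 'I_r' -> 'I_r,
    [/\ bijective s, a = a' \oc pi_map T s & psi \o s = psi'].
Proof.
move=> aA a'A e.
have [d [dI dpsi a'd]] := factorization_unique
  (structural_pi_map T psi) (structural_pi_map T psi') aA a'A e.
have ? := is_iso_eq dI; subst r'.
have [ndT rhoT] := proj1 simple_automorphismsP simpleT.
have [[s b] dE] := rhoT _ _ dI.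
have bE i : sval (b i) \oc proj T (psi (s i)) = proj T (psi' i).
  by have := congr1 (comp (proj T i)) dpsi; rewrite dE compA rho_morE -compA !proj_pi_map.
have psis i : psi (s i) = psi' i.
  apply: (@nondegenerate_proj_eq _ _ _ (sval (b i)) (idm T 1)) => //.
    exact: svalP (b i).
  by rewrite bE comp1m.
exists s; split; [by exists (s^-1)%g; [exact: permK|exact: permKV] | | exact: funext].
rewrite -a'd; congr (_ \oc _); apply: proj_inj => i.
rewrite dE rho_morE proj_pi_map; suff -> : sval (b i) = idm T 1 by rewrite comp1m.
by apply: (@proj_epic _ (psi (s i))); rewrite bE comp1m psis.
Qed.

End SimpleAutomorphisms.

Lemma analytic_factor (T : lawvere) n m (f : hom T n m) : analytic_theory T ->
  exists r (a : hom T r m) (psi : 'I_r -> 'I_n), analytic a /\ f = a \oc pi_map T psi.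
Proof.
move=> [[_ _ _ fact] simpleT]; have [z [s [a [sS aA ->]]]] := fact _ _ f.
have [j [psi [jI ->]]] := structuralP simpleT sS.
exists z, (a \oc j), psi; rewrite compA; split=> //.
by apply: analytic_comp aA _; apply: analytic_iso.
Qed.

(** If [phi] identified two indices, the inverse would identify the corresponding projections,
    contrary to nondegeneracy. *)
Lemma pi_map_iso_bij (T : lawvere) n m (phi : 'I_m -> 'I_n) :
  simple_automorphisms T -> is_iso (pi_map T phi) -> bijective phi.
Proof.
move=> simpleT phiI; have ? := is_iso_eq simpleT phiI; subst m.
apply: injF_bij => i j eij; have [u [_ uK]] := phiI.
apply: (@nondegenerate_proj_eq T _ _ _ (idm T 1) (idm T 1)).
- exact: simple_nondegenerate.
- exact: is_iso_id.
- have pE l : proj T (phi l) \oc u = proj T l by rewrite -proj_pi_map -compA uK compm1.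
  by rewrite -(pE i) -(pE j) eij.
Qed.

(** * Interpretations *)

Section Interpretations.
Variables (T T' : lawvere) (I : interpretation T T').

Lemma imap_tupling n m (t : 'I_m -> hom T n 1) :
  I _ _ (tupling t) = tupling (fun i => I _ _ (t i)).
Proof.
by apply: proj_inj => i; rewrite proj_tupling -(imap_proj I) -imap_comp proj_tupling.
Qed.

Lemma imap_pi_map n m (phi : 'I_m -> 'I_n) : I _ _ (pi_map T phi) = pi_map T' phi.
Proof. by rewrite imap_tupling; congr tupling; apply: funext => i; rewrite imap_proj. Qed.

Lemma imap_prod_map n (a : 'I_n -> hom T 1 1) :
  I _ _ (prod_map a) = prod_map (fun i => I _ _ (a i)).
Proof.
by rewrite imap_tupling; congr tupling; apply: funext => i; rewrite imap_comp imap_proj.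
Qed.

Lemma imap_prod_block k (n : 'I_k -> nat) (g : forall i, hom T (n i) 1) :
  I _ _ (prod_block g) = prod_block (fun i => I _ _ (g i)).
Proof.
by rewrite imap_tupling; congr tupling; apply: funext => i; rewrite imap_comp imap_pi_map.
Qed.

Lemma imap_is_iso n m (f : hom T n m) : is_iso f -> is_iso (I _ _ f).
Proof. by move=> [g [gf fg]]; exists (I _ _ g); rewrite /inverse_of -!imap_comp gf fg !imap_id. Qed.

Lemma imap_structural n m (f : hom T n m) : structural f -> structural (I _ _ f).
Proof.
move=> [x [y [_ [[phi ->] [i [j [iI jI e]]]]]]].
exists x, y, (pi_map T' phi); split; first by exists phi.
exists (I _ _ i), (I _ _ j); split; try exact: imap_is_iso.
by rewrite -imap_pi_map -!imap_comp e.
Qed.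

(** Every object is a power of [1], so bijectivity into [1] extends componentwise to all hom-sets;
    injectivity then makes the chosen preimages functorial. *)
Lemma bijective_imap_inverse : (forall n (f : hom T' n 1), exists! g, I _ _ g = f) ->
  is_iso (C := LT) I.
Proof.
move=> bijI.
have {}bijI n m (f : hom T' n m) : exists! g, I _ _ g = f.
  pose t i := sval (cid (bijI _ (proj T' i \oc f))).
  have tP i : unique (fun g => I _ _ g = proj T' i \oc f) (t i) by rewrite /t; case: cid.
  exists (tupling t); split=> [|g gf].
    by rewrite imap_tupling -[RHS]tupling_proj; congr tupling; apply: funext => i; case: (tP i).
  apply: proj_inj => i; rewrite proj_tupling; case: (tP i) => _; apply.
  by rewrite imap_comp gf imap_proj.
pose J n m (f : hom T' n m) := sval (cid (bijI _ _ f)).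
have IJ n m (f : hom T' n m) : I _ _ (J _ _ f) = f by rewrite /J; case: cid => g [].
have injI n m (g g' : hom T n m) : I _ _ g = I _ _ g' -> g = g'.
  by move=> e; have [h [_ hU]] := bijI _ _ (I _ _ g'); exact: etrans (esym (hU g e)) (hU g' erefl).
have J1 n : J _ _ (idm T' n) = idm T n by apply: injI; rewrite IJ imap_id.
have J2 n m k (g : hom T' m k) (f : hom T' n m) : J _ _ (g \oc f) = J _ _ g \oc J _ _ f.
  by apply: injI; rewrite imap_comp !IJ.
have J3 n (i : 'I_n) : J _ _ (proj T' i) = proj T i by apply: injI; rewrite IJ imap_proj.
exists (Interpretation J1 J2 J3); split; apply: interpretation_eq => n m f /=.
  by apply: injI; rewrite IJ.
exact: IJ.
Qed.

End Interpretations.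

(** * Invariance under isomorphism of theories *)

Section Isomorphisms.
Variables (T T' : lawvere) (I : hom LT T T') (J : hom LT T' T).
Hypothesis IJ : inverse_of I J.

Lemma imapK n m (f : hom T n m) : J _ _ (I _ _ f) = f.
Proof. by have := congr1 (fun K : interpretation T T => K _ _ f) (proj1 IJ). Qed.

Lemma imapVK n m (f : hom T' n m) : I _ _ (J _ _ f) = f.
Proof. by have := congr1 (fun K : interpretation T' T' => K _ _ f) (proj2 IJ). Qed.

(** It suffices to lift against renamings, which [I] and [J] both preserve: the problem is moved
    along [J], solved, and its diagonal moved back. *)
Lemma iso_analytic_interpretation : analytic_interpretation I.
Proof.
move=> n m a aA; apply: analyticP => k l phi u v e.
have e' : a \oc J _ _ u = J _ _ v \oc pi_map T phi.
  by rewrite -[a]imapK -imap_comp e imap_comp imap_pi_map.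
have [d [[ds ad] d_uniq]] := aA _ _ _ (structural_pi_map T phi) _ _ e'.
exists (I _ _ d); split.
  by rewrite -(imap_pi_map I) -!imap_comp ds ad !imapVK.
move=> d1 [d1s ad1]; rewrite -[d1]imapVK; congr (I _ _ _); apply: d_uniq; split.
  by rewrite -(imap_pi_map J) -imap_comp d1s.
by rewrite -[a]imapK -imap_comp ad1.
Qed.
End Isomorphisms.

Lemma inverse_of_sym (Ob : Type) (C : category Ob) x y (f : hom C x y) g :
  inverse_of f g -> inverse_of g f.
Proof. by case. Qed.

Lemma rigid_theory_iso (T T' : lawvere) (I : hom LT T T') :
  is_iso I -> rigid_theory T -> rigid_theory T'.
Proof.
move=> [J IJ] [[[_ _ _ fact] simpleT] rigidT].
have JI := inverse_of_sym IJ.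
split; last first.
  move=> n s f fA fs; apply: (rigidT _ _ (J _ _ f)).
    exact: iso_analytic_interpretation JI _ _ _ fA.
  by rewrite -(imap_pi_map J) -imap_comp fs.
split.
  split.
  - exact: iso_closure_iso_closed.
  - exact: right_orthogonal_iso_closed.
  - by move=> x y z t s a sS aA; apply: aA.
  move=> x y f; have [z [s [a [sS aA e]]]] := fact _ _ (J _ _ f).
  exists z, (I _ _ s), (I _ _ a); split; first exact: imap_structural.
    exact: iso_analytic_interpretation IJ _ _ _ aA.
  by rewrite -[f](imapVK IJ) e imap_comp.
(* In this form the condition transports piecewise: [J] would carry degeneracy of [T'] to [T], and
   [I] preserves decompositions. *)
have [ndT rhoT] := proj1 (simple_automorphismsP T) simpleT.
apply/simple_automorphismsP; split.
  by move=> e; apply: ndT; rewrite -!(imap_proj J) e.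
move=> n f fI; have [[s a] e] := rhoT _ _ (imap_is_iso J fI).
exists (s, fun i => exist _ (I _ _ (sval (a i))) (imap_is_iso I (svalP (a i)))).
by rewrite -[f](imapVK IJ) e /rho_mor imap_comp imap_prod_map imap_pi_map.
Qed.

(** * The theory of a symmetric operad *)

Section PaTheory.
Variable O : operad.
Let PO := Pa_ob O.

(** Up to [term_equiv], terms in [n] variables are exactly the morphisms [n -> 1], by [term_homK],
    [term_hom_equiv] and [term_hom_inj]. *)
Definition term_hom n (t : term O n) : hom PO n 1 :=
  span_class (span_of (fun _ : 'I_1 => t)).

Definition op_hom r (g : O r) : hom PO r 1 := term_hom (Term g id).

Lemma hom_term_term_hom n (t : term O n) i : term_equiv (hom_term (term_hom t) i) t.
Proof. by have := hom_term_class (span_of (fun=> t)) i; rewrite span_term_of. Qed.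

Lemma term_hom_equiv n (t u : term O n) : term_equiv t u -> term_hom t = term_hom u.
Proof.
move=> tu; apply: Pa_hom_eq => i; apply: term_equiv_trans (hom_term_term_hom _ _) _.
exact/(term_equiv_trans tu)/term_equiv_sym/hom_term_term_hom.
Qed.

Lemma term_homK n (A : hom PO n 1) : term_hom (hom_term A ord0) = A.
Proof.
by apply: Pa_hom_eq => i; rewrite [i]ord1; apply: hom_term_term_hom.
Qed.

Lemma term_hom_inj n r (g : O r) (phi : 'I_r -> 'I_n) (u : term O n) :
    term_hom (Term g phi) = term_hom u ->
  exists (g' : O r) (s : 'S_r), u = Term g' (phi \o s) /\ g = op_act s g'.
Proof.
move=> e; have : term_equiv (Term g phi) u.
  apply: term_equiv_trans (term_equiv_sym (hom_term_term_hom _ ord0)) _.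
  by rewrite e; apply: hom_term_term_hom.
move=> [r0 [g0 [g' [phi0 [phi' [s [e1 -> eg e2]]]]]]].
have ? := existT_inj1 e1; subst r0; have [-> ->] := Term_inj e1.
by exists g', s; split=> //; congr Term; apply/esym/funext.
Qed.

Lemma term_hom_act n r (s : 'S_r) (g : O r) (phi : 'I_r -> 'I_n) :
  term_hom (Term (op_act s g) phi) = term_hom (Term g (phi \o s)).
Proof. by apply: term_hom_equiv; exists r, (op_act s g), g, phi, (phi \o s), s. Qed.

Lemma term_hom_var n (i : 'I_n) : term_hom (var O i) = proj PO i.
Proof.
apply/esym; rewrite -[LHS]term_homK; apply: term_hom_equiv.
by rewrite -(span_term_proj O i ord0); apply: hom_term_class.
Qed.

Lemma op_hom_unit : op_hom op_unit = idm PO 1.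
Proof.
rewrite -proj_id1 -term_hom_var; congr (term_hom (Term _ _)).
by apply: funext => i; apply: ord1.
Qed.

Lemma hom_term_component n m (u : hom PO n m) i j :
  term_equiv (hom_term (proj PO i \oc u) j) (hom_term u i).
Proof. exact: hom_term_proj. Qed.

Lemma term_hom_comp n m (t : 'I_m -> term O n) (u : term O m) :
  term_hom u \oc tupling (fun i => term_hom (t i)) = term_hom (subst t u).
Proof.
rewrite -[LHS]term_homK; apply: term_hom_equiv.
apply: term_equiv_trans (hom_term_comp _ _ _) _.
apply: subst_equiv (hom_term_term_hom _ _) => i.
apply: term_equiv_trans (term_equiv_sym (hom_term_component _ _ ord0)) _.
by rewrite proj_tupling; apply: hom_term_term_hom.
Qed.

Lemma term_hom_pi_map n m r (g : O r) (phi : 'I_r -> 'I_m) (psi : 'I_m -> 'I_n) :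
  term_hom (Term g phi) \oc pi_map PO psi = term_hom (Term g (psi \o phi)).
Proof.
have -> : pi_map PO psi = tupling (fun i => term_hom (var O (psi i))).
  by congr tupling; apply: funext => i; rewrite term_hom_var.
rewrite term_hom_comp; congr term_hom; rewrite /subst /=.
apply: term_eq; first exact: op_comp1.
move=> e x /=; congr (psi (phi _)).
apply: (@mono_cast_ord _ _ (@tagnat.sig1 r (fun=> 1%N))) => a b /lt_sigP[//|].
by case=> _; rewrite !ord1.
Qed.

Lemma op_hom_pi_map n r (g : O r) (phi : 'I_r -> 'I_n) :
  op_hom g \oc pi_map PO phi = term_hom (Term g phi).
Proof. exact: term_hom_pi_map. Qed.

Lemma op_hom_act r (s : 'S_r) (g : O r) :
  op_hom (op_act s g) = op_hom g \oc pi_map PO s.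
Proof. by rewrite op_hom_pi_map [LHS]term_hom_act. Qed.

Lemma subst_op n k (m : 'I_k -> nat) (h : forall i, O (m i))
    (phi : forall i, 'I_(m i) -> 'I_n) (g : O k) :
  op_hom g \oc tupling (fun i => term_hom (Term (h i) (phi i))) =
  term_hom (Term (op_comp h g) (fun y => phi (tagnat.sig1 y) (tagnat.sig2 y))).
Proof. exact: term_hom_comp. Qed.

Lemma op_hom_comp k (m : 'I_k -> nat) (h : forall i, O (m i)) (g : O k) :
  op_hom (op_comp h g) = op_hom g \oc prod_block (fun i => op_hom (h i)).
Proof.
have -> : prod_block (fun i => op_hom (h i)) =
    tupling (fun i => term_hom (Term (h i) (tagnat.Rank i))).
  by congr tupling; apply: funext => i; rewrite op_hom_pi_map.
rewrite subst_op; congr (term_hom (Term _ _)).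
by apply: funext => y; rewrite tagnat.sig2K.
Qed.

(** The permutation witnessing the equivalence of the two terms carries the identity renaming to
    itself, so it is trivial. *)
Lemma op_hom_inj r : injective (@op_hom r).
Proof.
move=> g g' /term_hom_inj[g0 [s [e ->]]]; have [-> es] := Term_inj e.
have -> : s = 1%g by apply/permP => i; rewrite perm1 -[LHS]/((id \o s) i) -es.
by rewrite op_act1.
Qed.

Lemma op_hom_factor n (f : hom PO n 1) :
  exists r (g : O r) (phi : 'I_r -> 'I_n), f = op_hom g \oc pi_map PO phi.
Proof.
rewrite -[f]term_homK; case: (hom_term f ord0) => r [g phi].
by exists r, g, phi; rewrite op_hom_pi_map.
Qed.

(** Each component is a term with its own list of variables, and [phi] concatenates these lists.
    This becomes the structural-analytic factorization once operations are known to be analytic. *)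
Lemma prod_block_factor n m (f : hom PO n m) :
  exists (k : 'I_m -> nat) (g : forall i, O (k i)) (phi : 'I_(\sum_i k i) -> 'I_n),
    f = prod_block (fun i => op_hom (g i)) \oc pi_map PO phi.
Proof.
pose t i := hom_term (proj PO i \oc f) ord0.
exists (fun i => projT1 (t i)), (fun i => (projT2 (t i)).1).
exists (fun y => (projT2 (t (tagnat.sig1 y))).2 (tagnat.sig2 y)).
apply: proj_inj => i; rewrite compA proj_tupling -compA pi_map_comp -[LHS]term_homK -/(t i).
rewrite op_hom_pi_map; transitivity (term_hom (Term (projT2 (t i)).1 (projT2 (t i)).2)).
  by case: (t i) => r [].
congr (term_hom (Term _ _)); apply: funext => j.
by rewrite /= /tagnat.sig1 /tagnat.sig2 sig_Rank.
Qed.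

Lemma Pa_nondegenerate : nondegenerate PO.
Proof.
rewrite /nondegenerate -!term_hom_var => /term_hom_inj[g' [s [e _]]].
by have [_ /(congr1 (fun phi => phi ord0))] := Term_inj e.
Qed.

(** Substituting [f'] into a component of [f] gives a term equivalent to a variable; substitution
    adds arities and equivalence preserves them. *)
Lemma inverse_arity n m (f : hom PO n m) (f' : hom PO m n) i :
    f \oc f' = idm PO m ->
  \sum_(a < projT1 (hom_term f i))
    projT1 (hom_term f' ((projT2 (hom_term f i)).2 a)) = 1.
Proof.
move=> e; have : term_equiv (subst (hom_term f') (hom_term f i)) (var O i).
  apply: term_equiv_trans (term_equiv_sym (hom_term_comp _ _ _)) _.
  have := hom_term_id O i; rewrite -[Pa_id O m]/(idm PO m) -e; exact.
move=> [r [g [g' [phi [phi' [s [e1 e2 _ _]]]]]]].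
have er := congr1 (@projT1 _ _) e2; rewrite /= in er.
have := congr1 (@projT1 _ _) e1; rewrite /= -er => <-.
by case: (hom_term f i) => ? [].
Qed.

(** No arity vanishes, as an empty sum is not [1]; hence a component of arity [r] yields [r]
    positive numbers whose sum is [1]. *)
Lemma iso_arity n m (f : hom PO n m) i : is_iso f -> projT1 (hom_term f i) = 1%N.
Proof.
move=> [f' [f'f ff']].
have pos p q (h : hom PO p q) (h' : hom PO q p) j : h \oc h' = idm PO q ->
    (0 < projT1 (hom_term h j))%N.
  move=> /(@inverse_arity _ _ _ _ j).
  by case: (hom_term h j) => -[|r] [g phi] //=; rewrite big_ord0.
apply/eqP; rewrite eqn_leq (pos _ _ _ _ _ ff') andbT.
rewrite -(inverse_arity i ff') -[leqLHS]card_ord -sum1_card.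
by apply: leq_sum => a _; apply: pos f'f.
Qed.

Lemma iso_proj n m (f : hom PO n m) i : is_iso f ->
  exists x : hom PO 1 1 * 'I_n, proj PO i \oc f = x.1 \oc proj PO x.2.
Proof.
move=> fI; have := iso_arity i fI.
have -> : proj PO i \oc f = term_hom (hom_term f i).
  by rewrite -[LHS]term_homK; apply/term_hom_equiv/hom_term_component.
case: (hom_term f i) => r [g phi] /= er; subst r.
exists (op_hom g, phi ord0).
rewrite -[RHS]/(op_hom g \oc proj PO (phi ord0)) -pi_map1 op_hom_pi_map.
by congr (term_hom (Term _ _)); apply: funext => j; rewrite [j]ord1.
Qed.

(** Each component of an automorphism or of its inverse is a unary operation applied to one
    variable; composing the two shows that the index maps and the unary operations are mutually
    inverse. *)
Lemma Pa_simple : simple_automorphisms PO.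
Proof.
apply/simple_automorphismsP; split; first exact: Pa_nondegenerate.
move=> n f fI; have [f' [f'f ff']] := fI.
have f'I : is_iso f' by exists f.
have /choice[x xP] i := iso_proj i fI; have /choice[y yP] i := iso_proj i f'I.
have comp_id (g g' : hom PO n n) (u v : 'I_n -> hom PO 1 1 * 'I_n) i :
    (forall i, proj PO i \oc g = (u i).1 \oc proj PO (u i).2) ->
    (forall i, proj PO i \oc g' = (v i).1 \oc proj PO (v i).2) ->
    g \oc g' = idm PO n ->
  (v (u i).2).2 = i /\ (u i).1 \oc (v (u i).2).1 = idm PO 1.
  move=> uP vP /(congr1 (comp (proj PO i))).
  rewrite compm1 compA uP -compA vP compA => e.
  have ei : i = (v (u i).2).2.
    apply: (@nondegenerate_proj_eq _ _ _ _ (idm PO 1) _ Pa_nondegenerate (is_iso_id _ _)).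
    by rewrite comp1m; apply/esym/e.
  by split=> //; apply: (@proj_epic _ _ i); rewrite {3}ei e comp1m.
have yx i := comp_id _ _ _ _ i xP yP ff'.
have xy i := comp_id _ _ _ _ i yP xP f'f.
have xI i : is_iso (x i).1.
  exists (y (x i).2).1; split; last by case: (yx i).
  by case: (xy (x i).2); rewrite (proj1 (yx i)).
have x_inj : injective (fun i => (x i).2).
  by apply: (can_inj (g := fun j => (y j).2)) => i; case: (yx i).
exists (perm x_inj, fun i => exist _ (x i).1 (xI i)).
by apply: proj_inj => i; rewrite rho_morE xP permE.
Qed.

(** Equivalent terms have the same operation up to a permutation, which is absorbed into the
    renaming of [c]. *)
Lemma op_hom_pi_mapK k l r (h : O r) (alpha : 'I_r -> 'I_k) (phi : 'I_l -> 'I_k)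
    (c : hom PO l 1) :
  c \oc pi_map PO phi = op_hom h \oc pi_map PO alpha ->
  exists beta, c = op_hom h \oc pi_map PO beta.
Proof.
have [r' [g [delta ->]]] := op_hom_factor c.
rewrite !op_hom_pi_map term_hom_pi_map => /esym/term_hom_inj[g' [s [e ->]]].
have ? := existT_inj1 e; subst r'; have [-> _] := Term_inj e.
exists (delta \o (s^-1)%g); rewrite op_hom_pi_map term_hom_act.
by congr (term_hom (Term _ _)); apply: funext => i; rewrite /= permK.
Qed.

(** * Analytic morphisms for a rigid operad *)

Hypothesis rigidO : rigid_operad O.

(** The permutation relating the two terms fixes [g], so freeness makes it trivial. *)
Lemma rigid_term_hom_inj n r (g : O r) (phi phi' : 'I_r -> 'I_n) :
  term_hom (Term g phi) = term_hom (Term g phi') -> phi = phi'.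
Proof.
move=> /term_hom_inj[g' [s [/Term_inj[<- ->] /esym/rigidO ->]]].
by apply: funext => i; rewrite /= perm1.
Qed.

(** Both sides of a lifting square are terms on [op_comp h g], where the [h i] are the operations
    occurring in [u]. Cutting the variables of [v] into blocks gives the diagonal, and rigidity
    makes the blocks unique. *)
Lemma op_hom_analytic r (g : O r) : analytic (op_hom g).
Proof.
apply: analyticP => k l phi; apply: orthogonalI => u v e.
pose t i := hom_term (proj PO i \oc u) ord0.
pose m i := projT1 (t i); pose h i : O (m i) := (projT2 (t i)).1.
pose alpha i : 'I_(m i) -> 'I_k := (projT2 (t i)).2.
have uE i : proj PO i \oc u = term_hom (Term (h i) (alpha i)).
  by rewrite -[LHS]term_homK /h /alpha /m -/(t i); case: (t i) => ? [].
have {}uE : u = tupling (fun i => term_hom (Term (h i) (alpha i))).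
  by rewrite -[LHS]tupling_proj; congr tupling; apply: funext.
have [r' [w [beta vE]]] := op_hom_factor v.
move: e; rewrite {1}uE subst_op {1}vE op_hom_pi_map term_hom_pi_map.
move=> /term_hom_inj[w' [s [e hE]]].
have ? := existT_inj1 e; subst r'; have [/= ? bE] := Term_inj e; subst w'.
(* The operation of [v] is [op_comp h g] only up to the permutation [s]; [psi] is the renaming of
   [v] corrected by [s]. *)
pose psi := beta \o (s^-1)%g.
have vpsi : v = term_hom (Term (op_comp h g) psi).
  rewrite hE term_hom_act vE op_hom_pi_map; congr (term_hom (Term _ _)).
  by apply: funext => i; rewrite /psi /= permK.
have phi_psi i j : phi (psi (tagnat.Rank i j)) = alpha i j.
  have := congr1 (fun b => b (s^-1%g (tagnat.Rank i j))) bE.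
  by rewrite /= permKV /tagnat.sig1 /tagnat.sig2 sig_Rank.
have gd (d : hom PO l r) (delta : forall i, 'I_(m i) -> 'I_l) :
    (forall i, proj PO i \oc d = term_hom (Term (h i) (delta i))) ->
  op_hom g \oc d = term_hom (Term (op_comp h g) (fun y => delta (tagnat.sig1 y) (tagnat.sig2 y))).
  move=> dE; rewrite -subst_op; congr (_ \oc _).
  by rewrite -[LHS]tupling_proj; congr tupling; apply: funext.
pose d0 := tupling (fun i => term_hom (Term (h i) (psi \o tagnat.Rank i))).
have d0s : d0 \oc pi_map PO phi = u.
  rewrite /d0 tupling_comp uE; congr tupling; apply: funext => i.
  rewrite term_hom_pi_map; congr (term_hom (Term _ _)).
  by apply: funext => j; rewrite /= phi_psi.
have gd0 : op_hom g \oc d0 = v.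
  rewrite (gd _ (fun i => psi \o tagnat.Rank i)) => [|i]; last by rewrite proj_tupling.
  by rewrite vpsi; congr (term_hom (Term _ _)); apply: funext => y; rewrite /= tagnat.sig2K.
suff d_uniq (d : hom PO l r) :
    d \oc pi_map PO phi = u -> op_hom g \oc d = v -> d = d0 by exists d0; split.
move=> ds gdv.
(* Every diagonal uses the same operations [h i], since renaming its variables gives [u]; only its
   own renamings remain to be determined. *)
have lift i : exists delta, proj PO i \oc d = op_hom (h i) \oc pi_map PO delta.
  apply: (@op_hom_pi_mapK k l _ (h i) (alpha i) phi) => //.
  by rewrite -compA ds uE proj_tupling op_hom_pi_map.
pose delta i := sval (cid (lift i)).
have dE i : proj PO i \oc d = term_hom (Term (h i) (delta i)).
  by rewrite -op_hom_pi_map /delta; case: cid.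
move: gdv; rewrite (gd _ _ dE) vpsi => /rigid_term_hom_inj psiE.
apply: proj_inj => i; rewrite dE proj_tupling -psiE; congr (term_hom (Term _ _)).
by apply: funext => j; rewrite /= /tagnat.sig1 /tagnat.sig2 sig_Rank.
Qed.

Lemma Pa_pi_map_bij n m k (f : hom PO m k) (phi : 'I_m -> 'I_n) :
  analytic f -> analytic (f \oc pi_map PO phi) -> bijective phi.
Proof.
move=> fA fphiA; have phiI := analytic_pi_map_iso fA fphiA.
exact: pi_map_iso_bij Pa_simple phiI.
Qed.

Lemma Pa_rigid : rigid_theory PO.
Proof.
split; last first.
  move=> n s f fA; have [r [g [phi fE]]] := op_hom_factor f.
  (* Analyticity makes [phi] bijective, so that [s \o phi = phi] will give [s = 1]. *)
  have [psi _ psiK] : bijective phi.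
    apply: (@Pa_pi_map_bij _ _ _ (op_hom g)); first exact: op_hom_analytic.
    by rewrite -fE.
  rewrite fE op_hom_pi_map term_hom_pi_map => /rigid_term_hom_inj sE.
  by apply/permP => i; rewrite perm1 -[i]psiK -[LHS]/((s \o phi) _) sE.
split; last exact: Pa_simple.
split.
- exact: iso_closure_iso_closed.
- exact: right_orthogonal_iso_closed.
- by move=> x y z t s a sS aA; apply: aA.
move=> n m f; have [k [g [phi ->]]] := prod_block_factor f.
exists (\sum_i k i), (pi_map PO phi), (prod_block (fun i => op_hom (g i))).
split=> //; first exact: structural_pi_map.
by apply: prod_block_analytic => i; apply: op_hom_analytic.
Qed.

(** Analyticity makes the renaming in the decomposition bijective, so the action on the operation
    absorbs it. *)
Lemma analytic_op_hom n (f : hom PO n 1) : analytic f -> exists g : O n, f = op_hom g.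
Proof.
have [r [g [phi ->]]] := op_hom_factor f => fA.
have phi_bij := Pa_pi_map_bij (@op_hom_analytic _ g) fA.
have ? : r = n by have := bij_eq_card phi_bij; rewrite !card_ord.
subst r; exists (op_act (perm (bij_inj phi_bij)) g).
by rewrite op_hom_act; congr (_ \oc pi_map _ _); apply: funext => i; rewrite permE.
Qed.

End PaTheory.

(** * Interpretations between theories of operads *)

Section PaMorphisms.
Variables O P : operad.

Lemma Pa_mor_op_hom (h : operad_mor O P) r (g : O r) :
  Pa_mor h _ _ (op_hom g) = op_hom (h r g).
Proof.
rewrite [LHS]Pa_map_class /op_hom /term_hom; apply: (congr1 (@span_class _ _ _)).
apply: span_map_eq => i; rewrite /= omap_cast.
by congr op_cast; apply: eq_irrelevance.
Qed.

(** Operations generate the theory through products and renamings, which every interpretation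
    preserves. *)
Lemma interpretation_op_hom_eq (T : lawvere) (I J : interpretation (Pa_ob O) T) :
  (forall r (g : O r), I _ _ (op_hom g) = J _ _ (op_hom g)) -> I = J.
Proof.
move=> IJ; apply: interpretation_eq => n m f.
have [k [g [phi ->]]] := prod_block_factor f.
rewrite !imap_comp !imap_pi_map !imap_prod_block; congr (_ \oc _).
by apply: eq_prod_block => i; apply: IJ.
Qed.

Hypotheses (rigidO : rigid_operad O) (rigidP : rigid_operad P).

(** An analytic morphism is a product of operations after a bijective renaming, and [Pa_mor h]
    preserves this shape. *)
Lemma Pa_mor_analytic (h : operad_mor O P) : analytic_interpretation (Pa_mor h).
Proof.
move=> n m f; have [k [g [phi ->]]] := prod_block_factor f => fA.
have phi_bij : bijective phi.
  apply: (@Pa_pi_map_bij _ _ _ _ (prod_block (fun i => op_hom (g i)))) => //.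
  by apply: prod_block_analytic => i; apply: op_hom_analytic.
rewrite imap_comp imap_pi_map imap_prod_block; apply: analytic_comp.
  by apply: prod_block_analytic => i; rewrite Pa_mor_op_hom; apply: op_hom_analytic.
exact/analytic_iso/pi_map_bij_iso.
Qed.

(** Operations are exactly the analytic morphisms into [1], so [I] maps operations to operations;
    injectivity of [op_hom] turns the functor laws of [I] into those of an operad morphism. *)
Lemma Pa_full (I : interpretation (Pa_ob O) (Pa_ob P)) :
  analytic_interpretation I -> exists h : operad_mor O P, Pa_mor h = I.
Proof.
move=> IA.
have IP r (g : O r) : exists g' : P r, I _ _ (op_hom g) = op_hom g'.
  by apply: analytic_op_hom => //; apply: IA; apply: op_hom_analytic.
pose h r (g : O r) := sval (cid (IP r g)).
have hP r (g : O r) : I _ _ (op_hom g) = op_hom (h r g) by rewrite /h; case: cid.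
have h1 : h 1%N op_unit = op_unit.
  by apply: op_hom_inj; rewrite -hP !op_hom_unit imap_id.
have h2 k (n : 'I_k -> nat) (g : forall i, O (n i)) (f : O k) :
    h _ (op_comp g f) = op_comp (fun i => h _ (g i)) (h _ f).
  apply: op_hom_inj; rewrite -hP !op_hom_comp imap_comp imap_prod_block hP.
  by congr (_ \oc _); apply: eq_prod_block => i; rewrite hP.
have h3 n (s : 'S_n) (f : O n) : h _ (op_act s f) = op_act s (h _ f).
  by apply: op_hom_inj; rewrite -hP !op_hom_act imap_comp imap_pi_map hP.
exists (OperadMor h1 h2 h3); apply: interpretation_op_hom_eq => r g.
by rewrite Pa_mor_op_hom hP.
Qed.

End PaMorphisms.

(** * The operad of analytic operations of a rigid theory *)

Section AnalyticOperad.
Variable T : lawvere.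
Implicit Types n m k : nat.

Definition ana n := {f : hom T n 1 | analytic f}.

Definition ana_unit : ana 1 := exist _ (idm T 1) (analytic_iso (is_iso_id _ _)).

Lemma ana_comp_proof k (n : 'I_k -> nat) (g : forall i, ana (n i)) (f : ana k) :
  analytic (sval f \oc prod_block (fun i => sval (g i))).
Proof.
by apply: analytic_comp (svalP f) _; apply: prod_block_analytic => i; apply: (svalP (g i)).
Qed.

Definition ana_comp k (n : 'I_k -> nat) (g : forall i, ana (n i)) (f : ana k) :
    ana (\sum_i n i) :=
  exist _ (sval f \oc prod_block (fun i => sval (g i))) (@ana_comp_proof _ _ g f).

Lemma ana_act_proof n (s : 'S_n) (f : ana n) : analytic (sval f \oc pi_map T s).
Proof.
apply: analytic_comp (svalP f) _; apply: analytic_iso; apply: pi_map_bij_iso.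
by exists (s^-1)%g; [apply: permK | apply: permKV].
Qed.

Definition ana_act n (s : 'S_n) (f : ana n) : ana n :=
  exist _ (sval f \oc pi_map T s) (@ana_act_proof _ s f).

(* Arities are only propositionally equal in the operad laws; the renaming
   relating the two sides is strictly increasing, hence is the transport. *)
Lemma ana_same_op m n (f : ana m) (f' : ana n) (h : 'I_n -> 'I_m) :
    {homo h : x y / (x < y)%N} -> n = m -> sval f = sval f' \oc pi_map T h ->
  same_op f f'.
Proof.
move=> mono_h e; have := mono_cast_ord mono_h e; case: _ / e f h {mono_h} => f h hE.
have -> : h = id by apply: funext => i; rewrite hE cast_ord_id.
by rewrite pi_map_id compm1 => /(@sval_inj _ (fun f => analytic f)) ->.
Qed.

Lemma ana_act1 n (f : ana n) : ana_act 1%g f = f.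
Proof.
apply: sval_inj; rewrite /= -[RHS]compm1 -pi_map_id; congr (_ \oc pi_map _ _).
by apply: funext => i; rewrite perm1.
Qed.

Lemma ana_actM n (s t : 'S_n) (f : ana n) :
  ana_act (s * t)%g f = ana_act t (ana_act s f).
Proof.
apply: sval_inj; rewrite /= -compA pi_map_comp; congr (_ \oc pi_map _ _).
by apply: funext => i; rewrite permM.
Qed.

Lemma ana_comp1 n (f : ana n) : same_op (ana_comp (fun _ : 'I_n => ana_unit) f) f.
Proof.
apply: (ana_same_op (h := fun i => tagnat.Rank i ord0)).
- by move=> i j ltij; apply: lt_Rank; left.
- by rewrite sum_nat_const card_ord muln1.
rewrite /=; congr (_ \oc tupling _); apply: funext => i.
by rewrite comp1m -[LHS]comp1m -proj_id1 proj_pi_map.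
Qed.

Lemma ana_1comp n (f : ana n) : same_op (ana_comp (fun _ : 'I_1 => f) ana_unit) f.
Proof.
apply: (ana_same_op (h := @tagnat.Rank 1 (fun=> n) ord0)).
- by move=> i j ltij; apply: lt_Rank; right.
- by rewrite big_ord1.
by rewrite /= comp1m -[LHS]comp1m -proj_id1 proj_tupling.
Qed.

Lemma sum_tagnat k (n : 'I_k -> nat) (m : forall i, 'I_(n i) -> nat) :
  \sum_(l < \sum_i n i) m (tagnat.sig1 l) (tagnat.sig2 l) = \sum_i \sum_j m i j.
Proof.
by rewrite [RHS]sig_big_dep /= [RHS](reindex _ tagnat.sig_bij_on).
Qed.

Lemma ana_compA k (n : 'I_k -> nat) (m : forall i, 'I_(n i) -> nat)
    (h : forall i j, ana (m i j)) (g : forall i, ana (n i)) (f : ana k) :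
  same_op (ana_comp (fun i => ana_comp (h i) (g i)) f)
    (ana_comp (fun l => h (tagnat.sig1 l) (tagnat.sig2 l)) (ana_comp g f)).
Proof.
(* [R] regroups [<<i, j>, x>] as [<i, <j, x>>]; the two lexicographic orders agree, so it is
   increasing. *)
pose R (y : 'I_(\sum_(l < \sum_i n i) m (tagnat.sig1 l) (tagnat.sig2 l))) :=
  @tagnat.Rank k (fun i => \sum_j m i j) (tagnat.sig1 (tagnat.sig1 y))
    (@tagnat.Rank _ (m _) (tagnat.sig2 (tagnat.sig1 y)) (tagnat.sig2 y)).
apply: (ana_same_op (h := R)).
- move=> a b /lt_sigP lt_ab; apply: lt_Rank.
  move: lt_ab; move: (tagnat.sig2 a) (tagnat.sig2 b).
  move: (tagnat.sig1 a) (tagnat.sig1 b) => {a b} l l' x x' [/lt_sigP|[ell]].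
    move: x x'; move: (tagnat.sig2 l) (tagnat.sig2 l').
    move: (tagnat.sig1 l) (tagnat.sig1 l') => {l l'} a b c d x x' [ltab|[eab]].
      by left.
    case: _ / eab in d x' * => ltcd; right; split=> //.
    by apply: lt_Rank; left.
  case: _ / ell in x' * => ltxx; right; split=> //.
  by apply: lt_Rank; right.
- exact: sum_tagnat.
rewrite /= -!compA; congr (_ \oc _).
rewrite [RHS]tupling_comp; congr tupling; apply: funext => i.
rewrite -[RHS]compA [prod_block _ \oc _]tupling_comp pi_map_tupling -compA tupling_comp.
congr (_ \oc tupling _).
apply: funext => j; rewrite -!compA !pi_map_comp.
(* The type of [tagnat.sig2] depends on [tagnat.sig1], so both are rewritten together, through
   functions of the pair. *)
pose F (p : {i : 'I_k & 'I_(n i)}) : hom T (\sum_i \sum_j m i j) 1 :=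
  sval (h (tag p) (tagged p)) \oc
  pi_map T (tagnat.Rank (tag p) \o tagnat.Rank (tagged p)).
transitivity (F (tagnat.sig (tagnat.Rank i j))); first by rewrite sig_Rank.
rewrite /F; move: (tagnat.Rank i j) => l; congr (_ \oc pi_map _ _); apply: funext => x.
pose G (p : {l : 'I_(\sum_i n i) & 'I_(m (tagnat.sig1 l) (tagnat.sig2 l))}) :=
  @tagnat.Rank k (fun i => \sum_j m i j) (tagnat.sig1 (tag p))
    (@tagnat.Rank _ (m _) (tagnat.sig2 (tag p)) (tagged p)).
by rewrite -[RHS]/(G (tagnat.sig (tagnat.Rank _ x))) sig_Rank.
Qed.

Lemma ana_comp_act k (n : 'I_k -> nat) (s : forall i, 'S_(n i)) (t : 'S_k)
    (g : forall i, ana (n i)) (f : ana k) :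
  same_op (ana_comp (fun i => ana_act (s i) (g i)) (ana_act t f))
    (ana_act (block_perm s t) (ana_comp (fun i => g (t i)) f)).
Proof.
apply: (ana_same_op (h := cast_ord (sum_perm_idx n t))) => //.
  exact: sum_perm_idx.
rewrite /= -!compA; congr (_ \oc _).
rewrite pi_map_tupling pi_map_comp tupling_comp; congr tupling; apply: funext => i.
rewrite -!compA !pi_map_comp; congr (_ \oc pi_map _ _); apply: funext => j.
rewrite /= permE /= cast_ord_comp cast_ord_id /block_fun.
by rewrite /tagnat.sig1 /tagnat.sig2 sig_Rank.
Qed.

Definition ana_operad : operad :=
  Operad ana_act1 ana_actM ana_comp1 ana_1comp ana_compA ana_comp_act.

Lemma ana_operad_rigid : rigid_theory T -> rigid_operad ana_operad.
Proof.
by move=> [_ rigidT] n s f /(congr1 sval) sf; apply: rigidT sf; apply: (svalP f).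
Qed.

Definition ev n (t : term ana_operad n) : hom T n 1 :=
  sval (projT2 t).1 \oc pi_map T (projT2 t).2.

Lemma ev_equiv n (t u : term ana_operad n) : term_equiv t u -> ev t = ev u.
Proof.
move=> [r [g [g' [phi [phi' [s [-> -> -> pp']]]]]]].
rewrite /ev /= -compA pi_map_comp; congr (_ \oc pi_map _ _); exact: funext.
Qed.

Lemma ev_subst n m (t : 'I_m -> term ana_operad n) (u : term ana_operad m) :
  ev (subst t u) = ev u \oc tupling (fun i => ev (t i)).
Proof.
case: u => r [g psi]; rewrite /ev /= -!compA pi_map_tupling tupling_comp.
congr (_ \oc tupling _); apply: funext => i.
rewrite -compA pi_map_comp; congr (_ \oc pi_map _ _); apply: funext => j.
by rewrite /= /tagnat.sig1 /tagnat.sig2 sig_Rank.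
Qed.

Lemma ev_var n (i : 'I_n) : ev (var ana_operad i) = proj T i.
Proof. by rewrite /ev /= pi_map1 comp1m. Qed.

Let ev_hom n m (A : hom (Pa_ob ana_operad) n m) : hom T n m :=
  tupling (fun i => ev (hom_term A i)).

Let ev_hom_id n : ev_hom (idm _ n) = idm T n.
Proof.
apply: proj_inj => i; rewrite proj_tupling compm1 -ev_var.
exact/ev_equiv/hom_term_id.
Qed.

Let ev_hom_comp n m k (B : hom (Pa_ob ana_operad) m k) (A : hom _ n m) :
  ev_hom (B \oc A) = ev_hom B \oc ev_hom A.
Proof.
apply: proj_inj => i; rewrite compA !proj_tupling -ev_subst.
exact/ev_equiv/hom_term_comp.
Qed.

Let ev_hom_term_hom n (t : term ana_operad n) : ev_hom (term_hom t) = ev t.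
Proof.
rewrite -[LHS]comp1m -proj_id1 proj_tupling; exact/ev_equiv/hom_term_term_hom.
Qed.

Let ev_hom_proj n (i : 'I_n) : ev_hom (proj _ i) = proj T i.
Proof. by rewrite -term_hom_var ev_hom_term_hom ev_var. Qed.

Definition ev_interpretation : interpretation (Pa_ob ana_operad) T :=
  Interpretation ev_hom_id ev_hom_comp ev_hom_proj.

(** Surjectivity into [1] is the existence of a factorization into a renaming and an analytic
    morphism; injectivity is its uniqueness up to a permutation, which is equivalence of terms. *)
Lemma ev_interpretation_iso : analytic_theory T -> is_iso (C := LT) ev_interpretation.
Proof.
move=> anaT; apply: bijective_imap_inverse => n f.
have [r [a [psi [aA fE]]]] := analytic_factor f anaT.
pose g : ana_operad r := exist _ a aA.
exists (term_hom (Term g psi)); split=> [|A Af].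
  by rewrite fE; apply: ev_hom_term_hom.
rewrite -[A]term_homK; move: Af; rewrite -[A]term_homK.
rewrite [X in X = _ -> _]ev_hom_term_hom term_homK.
case: (hom_term A ord0) => r' [[a' a'A] psi'].
rewrite fE /ev /= => /esym /(analytic_factor_unique (proj2 anaT) aA a'A).
move=> [s [s_bij aE sE]]; have er : r' = r.
  by have := bij_eq_card s_bij; rewrite !card_ord.
subst r'; apply: term_hom_equiv.
exists r, g, (exist _ a' a'A), psi, psi', (perm (bij_inj s_bij)); split=> //.
  apply: sval_inj; rewrite /= aE; congr (_ \oc pi_map _ _).
  by apply: funext => i; rewrite permE.
by move=> i; rewrite /= permE -sE.
Qed.

End AnalyticOperad.

Theorem proposition4p6 : is_essential_image Pp RiLT.
Proof.
split.
  move=> T T' I rigidT II; have rigidT' := rigid_theory_iso II rigidT.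
  by split=> //; case: II => J IJ; apply: iso_analytic_interpretation IJ.
have Fob (x : sub_ob RiOp) : in_ob RiLT (fobj Pp x) by apply: Pa_rigid (svalP x).
have Fhom (x y : sub_ob RiOp) (f : hom (subcat RiOp) x y) : in_hom RiLT (fmap Pp f).
  exact: Pa_mor_analytic (svalP x) (svalP y) _.
exists Fob, Fhom; split.
  move=> x y [I IA]; have [h hI] := Pa_full (svalP x) (svalP y) IA.
  by exists (exist _ h Logic.I); apply: sval_inj.
(* The preimage of [T] is its operad of analytic operations; evaluation of terms is the isomorphism,
   and both it and its inverse are analytic. *)
move=> [T rigidT]; pose O := ana_operad T.
exists (exist _ O (ana_operad_rigid rigidT)).
have [J IJ] := ev_interpretation_iso (proj1 rigidT).
have IA := iso_analytic_interpretation IJ.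
have JA := iso_analytic_interpretation (inverse_of_sym IJ).
exists (exist _ (ev_interpretation T) IA), (exist _ J JA).
by split; apply: sval_inj; [case: IJ | case: IJ].
Qed.
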